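(* Let $Z$ be a spin factor with $\dim Z=k+1<\infty$ (so $k\ge 2$). Then, up to TRO-isomorphism, \[T^*(Z)=\begin{cases}\mathbb{M}_{2^{n-1}}\oplus\mathbb{M}_{2^{n-1}} & \text{if }k=2n-1,\\ \mathbb{M}_{2^{n}} & \text{if }k=2n.\end{cases}\]
   Context: $\mathbb{M}_n$ denotes the complex $n\times n$-matrices. A $JC^*$-triple system is a closed subspace of a $C^*$-algebra invariant under $\{a,b,c\}=\frac12(ab^*c+cb^*a)$; a $JB^*$-triple homomorphism (isomorphism) is a linear (bijective) map preserving the triple product. A spin system is a set $S=\{\mathrm{id},s_1,\ldots,s_k\}$, $k\ge2$, of self-adjoint elements of $B(H)$, $H$ a Hilbert space, with $s_is_j+s_js_i=2\delta_{i,j}\mathrm{id}$ for all $i,j\in\{1,\dots,k\}$. Its complex linear span is a $JC^*$-triple system of dimension $k+1$. A spin factor (of finite dimension $k+1$) is a $JC^*$-triple system that is $JB^*$-triple isomorphic to the complex linear span of such a spin system. A TRO is a closed subspace $T\subseteq B(H)$ with $xy^*z\in T$ for all $x,y,z\in T$; it carries the triple product $\frac12(xy^*z+zy^*x)$. TRO-homomorphisms are linear maps preserving $xy^*z$. The universal enveloping TRO of $Z$ is the TRO $T^*(Z)$, unique up to TRO-isomorphism, with a $JB^*$-triple homomorphism $\rho_Z:Z\to T^*(Z)$ such that $\rho_Z(Z)$ generates $T^*(Z)$ as a TRO and every $JB^*$-triple homomorphism $\alpha:Z\to T$ into a TRO $T$ factors as $\alpha=T^*(\alpha)\circ\rho_Z$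 with $T^*(\alpha):T^*(Z)\to T$ a TRO-homomorphism. *)

(* Defs.v *)
From HB Require Import structures.
From mathcomp Require Import all_boot all_order all_algebra complex.
From mathcomp Require Import all_classical all_reals.
From mathcomp Require Import topology normedtype.
From mathcomp Require Import ring lra.
Set Implicit Arguments.
Unset Strict Implicit.
Unset Printing Implicit Defensive.
Import Order.TTheory GRing.Theory Num.Theory.
Import numFieldNormedType.Exports.
Local Open Scope classical_set_scope.
Local Open Scope ring_scope.
Local Open Scope complex_scope.

Reserved Notation "x ** y" (at level 40, left associativity).
Reserved Notation "x ^**" (at level 2, format "x ^**").

(* Not necessarily unital, hence not built on the ring hierarchy. *)
HB.mixin Record Lmodule_isStarAlgebra (C : numClosedFieldType) A
    & GRing.Lmodule C A := {
  smul : A -> A -> A;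
  star : A -> A;
  smulA : associative smul;
  smul_linearl : forall y (a : C) x x',
    smul (a *: x + x') y = a *: smul x y + smul x' y;
  smul_linearr : forall x (a : C) y y',
    smul x (a *: y + y') = a *: smul x y + smul x y';
  star_conjlinear : forall (a : C) x y,
    star (a *: x + y) = Num.conj a *: star x + star y;
  starM : forall x y, star (smul x y) = smul (star y) (star x);
  starK : involutive star;
}.

#[short(type="starAlgType")]
HB.structure Definition StarAlgebra (C : numClosedFieldType) :=
  {A of GRing.Lmodule C A & Lmodule_isStarAlgebra C A}.

Notation "x ** y" := (smul x y) : ring_scope.
Notation "x ^**" := (star x) : ring_scope.

HB.mixin Record isCStarAlgebra (R : realType) A
    & StarAlgebra R[i] A & CompleteNormedModule R[i] A := {
  cstar_normM : forall x y : A, `|x ** y| <= `|x| * `|y|;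
  cstar_norm : forall x : A, `|x^** ** x| = `|x| ^+ 2;
}.

#[short(type="cstarAlgType")]
HB.structure Definition CStarAlgebra (R : realType) :=
  {A of StarAlgebra R[i] A & CompleteNormedModule R[i] A
   & isCStarAlgebra R A}.

(* The form of [{dot H for _}] is linear in its first argument. *)
HB.mixin Record isHilbert (R : realType) H & CompleteNormedModule R[i] H := {
  idot : {dot H for (Num.conj : R[i] -> R[i])};
  idot_norm : forall x : H, idot x x = `|x| ^+ 2;
}.
#[short(type="hilbertType")]
HB.structure Definition Hilbert (R : realType) :=
  {H of CompleteNormedModule R[i] H & isHilbert R H}.

(* The spaces of matrices carry the star-algebra structure with conjugate
   transposition; no norm is needed on them. *)
Section MatrixStar.
Variables (C : numClosedFieldType) (m : nat).
Implicit Types x y : 'M[C]_m.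
Definition mxstar x : 'M[C]_m := (map_mx Num.conj x)^T.
Lemma mxstar_conjlinear (a : C) x y :
  mxstar (a *: x + y) = Num.conj a *: mxstar x + mxstar y.
Proof. by apply/matrixP => i j; rewrite !mxE rmorphD rmorphM. Qed.
Lemma mxstarM x y : mxstar (x *m y) = mxstar y *m mxstar x.
Proof. by rewrite /mxstar map_mxM trmx_mul. Qed.
Lemma mxstarK : involutive mxstar.
Proof. by move=> x; apply/matrixP => i j; rewrite !mxE conjCK. Qed.
Lemma mx_linearl (y : 'M[C]_m) (a : C) (x x' : 'M[C]_m) :
  (a *: x + x') *m y = a *: (x *m y) + x' *m y.
Proof. by rewrite mulmxDl scalemxAl. Qed.
Lemma mx_linearr (x : 'M[C]_m) (a : C) (y y' : 'M[C]_m) :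
  x *m (a *: y + y') = a *: (x *m y) + x *m y'.
Proof. by rewrite mulmxDr scalemxAr. Qed.
HB.instance Definition _ := Lmodule_isStarAlgebra.Build C 'M[C]_m
  (@mulmxA _ m m m m) mx_linearl mx_linearr mxstar_conjlinear mxstarM mxstarK.
End MatrixStar.

Section PairStar.
Variables (C : numClosedFieldType) (A B : starAlgType C).
Implicit Types x y : A * B.
Definition pair_smul x y : A * B := (x.1 ** y.1, x.2 ** y.2).
Definition pair_star x : A * B := (x.1^**, x.2^**).
Lemma pair_smulA : associative pair_smul.
Proof. by move=> x y z; rewrite /pair_smul !smulA. Qed.
Lemma pair_linearl y (a : C) x x' :
  pair_smul (a *: x + x') y = a *: pair_smul x y + pair_smul x' y.
Proof. by congr pair; rewrite smul_linearl. Qed.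
Lemma pair_linearr x (a : C) y y' :
  pair_smul x (a *: y + y') = a *: pair_smul x y + pair_smul x y'.
Proof. by congr pair; rewrite smul_linearr. Qed.
Lemma pair_star_conjlinear (a : C) x y :
  pair_star (a *: x + y) = Num.conj a *: pair_star x + pair_star y.
Proof. by congr pair; rewrite star_conjlinear. Qed.
Lemma pair_starM x y :
  pair_star (pair_smul x y) = pair_smul (pair_star y) (pair_star x).
Proof. by congr pair; rewrite starM. Qed.
Lemma pair_starK : involutive pair_star.
Proof. by move=> [x y]; rewrite /pair_star !starK. Qed.
HB.instance Definition _ := Lmodule_isStarAlgebra.Build C (A * B)%type
  pair_smulA pair_linearl pair_linearr pair_star_conjlinear pair_starM
  pair_starK.
End PairStar.

Fact CS_aux (F : fieldType) (n X d e : F) : n != 0 ->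
  X - e / n * d - (d / n * e - d / n * (e / n * n)) = X - d * e / n.
Proof. by move=> n0; field. Qed.

Fact parallelogram_aux (F : fieldType) (xx yy xy yx : F) :
  xx - xy - (yx - yy) = 2 * xx + 2 * yy - (xx + xy + (yx + yy)).
Proof. by ring. Qed.

Section HilbertTheory.
Variables (R : realType) (H : hilbertType R).
Implicit Types (x y z : H) (a b : R[i]).
Local Notation C := R[i].

Lemma idotC x y : idot x y = Num.conj (idot y x).
Proof. by rewrite (@hermC C false Num.conj) expr0 mul1r. Qed.

Lemma idotDl x y z : idot (x + y) z = idot x z + idot y z.
Proof. exact: linearDl. Qed.
Lemma idotDr x y z : idot z (x + y) = idot z x + idot z y.
Proof. exact: linearDr. Qed.
Lemma idotZl a x y : idot (a *: x) y = a * idot x y.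
Proof. exact: linearZl_LR. Qed.
Lemma idotZr a x y : idot x (a *: y) = Num.conj a * idot x y.
Proof. exact: linearZr. Qed.
Lemma idotNl x y : idot (- x) y = - idot x y.
Proof. by rewrite -scaleN1r idotZl mulN1r. Qed.
Lemma idotNr x y : idot x (- y) = - idot x y.
Proof. by rewrite -scaleN1r idotZr rmorphN rmorph1 mulN1r. Qed.
Lemma idot0l x : idot 0 x = 0.
Proof. by rewrite -(scale0r 0) idotZl mul0r. Qed.
Lemma idot0r x : idot x 0 = 0.
Proof. by rewrite -(scale0r 0) idotZr conjC0 mul0r. Qed.
Lemma idotBl x y z : idot (x - y) z = idot x z - idot y z.
Proof. by rewrite idotDl idotNl. Qed.
Lemma idotBr x y z : idot z (x - y) = idot z x - idot z y.
Proof. by rewrite idotDr idotNr. Qed.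

Lemma idot_inj x y : (forall z, idot z x = idot z y) -> x = y.
Proof.
move=> e; apply/eqP; rewrite -subr_eq0 -normr_eq0 -sqrf_eq0 -idot_norm.
by rewrite idotBr e subrr.
Qed.

Lemma idot_CS x y : `|idot x y| <= `|x| * `|y|.
Proof.
have [->|y0] := eqVneq y 0; first by rewrite idot0r !normr0 mulr0.
have ny : 0 < `|y| ^+ 2 by rewrite exprn_gt0 ?normr_gt0.
rewrite -(@ler_pXn2r _ 2) ?nnegrE ?mulr_ge0//.
set t := idot x y / `|y| ^+ 2.
have : 0 <= `|x - t *: y| ^+ 2 by rewrite exprn_ge0.
rewrite -idot_norm !(idotBl, idotBr) !(idotZl, idotZr) !idot_norm.
rewrite (idotC y x).
have -> : Num.conj t = Num.conj (idot x y) / `|y| ^+ 2.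
  have hc : Num.conj (`|y| ^+ 2) = `|y| ^+ 2 :> C.
    by apply: conj_Creal; exact: ger0_real (exprn_ge0 2 (normr_ge0 y)).
  by rewrite rmorphM fmorphV /= hc.
rewrite /t CS_aux ?gt_eqF// -normCK.
by rewrite subr_ge0 ler_pdivrMr // exprMn.
Qed.

Lemma parallelogram x y :
  `|x - y| ^+ 2 = 2 * `|x| ^+ 2 + 2 * `|y| ^+ 2 - `|x + y| ^+ 2.
Proof.
by rewrite -!idot_norm !(idotBl, idotBr, idotDl, idotDr) parallelogram_aux.
Qed.

End HilbertTheory.

Section RealNorm.
Variables (R : realType).
Local Notation C := R[i].
Definition rnorm (V : normedZmodType C) (x : V) : R := complex.Re `|x|.
Section V.
Variable V : normedZmodType C.
Implicit Types x y : V.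
Lemma rnormE x : `|x| = (rnorm x)%:C.
Proof. by rewrite /rnorm RRe_real// ger0_real. Qed.
Lemma rnorm_le x y : (rnorm x <= rnorm y) = (`|x| <= `|y|).
Proof. by rewrite !rnormE lecR. Qed.
Lemma rnorm_ge0 x : 0 <= rnorm x.
Proof. by rewrite -lecR -rnormE; exact: normr_ge0. Qed.
Lemma rnormD x y : rnorm (x + y) <= rnorm x + rnorm y.
Proof. by rewrite -lecR rmorphD /= -!rnormE ler_normD. Qed.
Lemma rnormN x : rnorm (- x) = rnorm x.
Proof. by rewrite /rnorm normrN. Qed.
Lemma rnormB x y : rnorm (x - y) = rnorm (y - x).
Proof. by rewrite /rnorm distrC. Qed.
Lemma rnorm0 : rnorm (0 : V) = 0.
Proof. by rewrite /rnorm normr0. Qed.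
Lemma rnorm0_eq0 x : rnorm x = 0 -> x = 0.
Proof. by move=> x0; apply: normr0_eq0; rewrite rnormE x0. Qed.
End V.
Lemma rnormM (a b : C) : rnorm (a * b) = rnorm a * rnorm b.
Proof. by apply: (@complexI R); rewrite rmorphM /= -!rnormE normrM. Qed.
Lemma rnormZ (V : normedModType C) (a : C) (x : V) :
  rnorm (a *: x) = rnorm a * rnorm x.
Proof. by apply: (@complexI R); rewrite rmorphM /= -!rnormE normrZ. Qed.
Lemma rnorm_real (r : R) : 0 <= r -> rnorm r%:C = r.
Proof. by move=> r0; rewrite /rnorm ger0_norm ?lecR. Qed.
Lemma rnorm1 : rnorm (1 : C) = 1.
Proof. by rewrite /rnorm normr1. Qed.

Lemma real_complexX2 (r : R) : (r ^+ 2)%:C = r%:C ^+ 2 :> C.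
Proof. exact: (rmorphXn (real_complex R)). Qed.

Lemma small_le0 (z K : R) : 0 <= K ->
  (forall e, 0 < e -> z <= e * K) -> z <= 0.
Proof.
move=> K0 h; rewrite leNgt; apply/negP => z0.
have K1 : 0 < 2 * (K + 1) by lra.
have := h (z / (2 * (K + 1))) (divr_gt0 z0 K1).
rewrite mulrAC ler_pdivlMr// => h'; nra.
Qed.

Lemma gt0_complexE (e : C) : 0 < e -> exists2 r : R, 0 < r & e = r%:C.
Proof.
move=> e0; have eE : e = (complex.Re e)%:C by rewrite RRe_real// gtr0_real.
by exists (complex.Re e) => //; rewrite -ltcR -eE.
Qed.

Variable H : hilbertType R.
Implicit Types x y : H.
Lemma rnorm_idot x : idot x x = (rnorm x ^+ 2)%:C.
Proof. by rewrite idot_norm rnormE; exact/esym/(rmorphXn (real_complex R)). Qed.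
Lemma rnorm_CS x y : rnorm (idot x y) <= rnorm x * rnorm y.
Proof. by rewrite -lecR rmorphM /= -!rnormE idot_CS. Qed.
Lemma rnorm_idotE x : rnorm (idot x x) = rnorm x ^+ 2.
Proof. by rewrite rnorm_idot rnorm_real// exprn_ge0// rnorm_ge0. Qed.

Lemma rparallelogram x y :
  rnorm (x - y) ^+ 2 = 2 * rnorm x ^+ 2 + 2 * rnorm y ^+ 2 - rnorm (x + y) ^+ 2.
Proof.
apply: (@complexI R).
rewrite rmorphB rmorphD !rmorphM /= -!expr2 -!rnormE parallelogram.
by rewrite !(rmorph_nat (real_complex R) 2).
Qed.

Lemma rnorm_minimize x y : y != 0 ->
  rnorm (x - (idot x y / idot y y) *: y) ^+ 2 * rnorm y ^+ 2 =
  rnorm x ^+ 2 * rnorm y ^+ 2 - rnorm (idot x y) ^+ 2.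
Proof.
move=> y0; apply: (@complexI R).
have n0 : idot y y != 0.
  by rewrite idot_norm sqrf_eq0 normr_eq0.
have hc : Num.conj (idot y y) = idot y y by rewrite -idotC.
rewrite rmorphB !rmorphM /= -!expr2 -!rnormE -!idot_norm normCK.
rewrite !(idotBl, idotBr) !(idotZl, idotZr) (idotC y x).
rewrite rmorphM fmorphV /= hc.
by rewrite CS_aux// mulrBl divfK.
Qed.

End RealNorm.

Section Riesz.
Variables (R : realType) (H : hilbertType R).
Local Notation C := R[i].
Implicit Types x y k : H.
Variables (phi : H -> C) (M : R).
Hypothesis phiL : forall (a : C) x y, phi (a *: x + y) = a * phi x + phi y.
Hypothesis phiM : forall x, rnorm (phi x) <= M * rnorm x.

Let phi0 : phi 0 = 0.
Proof. by have := phiL (-1) 0 0; rewrite scaler0 addr0 mulN1r addNr. Qed.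
Let phiZ a x : phi (a *: x) = a * phi x.
Proof. by have := phiL a x 0; rewrite phi0 !addr0. Qed.
Let phiD x y : phi (x + y) = phi x + phi y.
Proof. by have := phiL 1 x y; rewrite scale1r mul1r. Qed.
Let phiB x y : phi (x - y) = phi x - phi y.
Proof. by rewrite phiD -scaleN1r phiZ mulN1r. Qed.

Let D := [set r : R | exists2 x, phi x = 1 & r = rnorm x ^+ 2].
Let d := inf D.
Let S (e : R) := [set x | phi x = 1 /\ rnorm x ^+ 2 < d + e].

Let d_le x : phi x = 1 -> d <= rnorm x ^+ 2.
Proof.
move=> px; apply: ge_inf; last by exists x.
by exists 0 => _ [y _ ->]; rewrite exprn_ge0// rnorm_ge0.
Qed.

Let S_sub e x y : S e x -> S e y -> rnorm (x - y) ^+ 2 <= 4 * e.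
Proof.
move=> [px lx] [py ly]; rewrite rparallelogram.
have := @d_le (2^-1 *: (x + y)).
rewrite phiZ phiD px py (mulVf (_ : 1 + 1 != 0)) ?(pnatr_eq0 _ 2)// => /(_ erefl).
rewrite rnormZ.
have -> : (2^-1 : C) = (2^-1 : R)%:C by rewrite fmorphV rmorph_nat.
rewrite rnorm_real ?invr_ge0// exprMn.
have -> : (2^-1 : R) ^+ 2 = 4^-1 by rewrite exprVn -natrX.
by rewrite ler_pdivlMl// => h; lra.
Qed.

Let S_orth e x k : 0 < e -> S e x -> phi k = 0 ->
  rnorm (idot x k) ^+ 2 <= e * rnorm k ^+ 2.
Proof.
move=> e0 [px lx] pk; have [->|k0] := eqVneq k 0.
  by rewrite idot0r !rnorm0 expr0n mulr0.
have := rnorm_minimize x k0.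
set z := x - _ => hz.
have pz : phi z = 1 by rewrite /z phiB phiZ pk mulr0 subr0.
have := d_le pz; have k2 : 0 <= rnorm k ^+ 2 by rewrite exprn_ge0 ?rnorm_ge0.
nra.
Qed.

Let S_near x0 : phi x0 != 0 -> exists p, forall e, 0 < e ->
  exists2 x, S e x & rnorm (p - x) < e.
Proof.
move=> px0.
have S_n0 e : 0 < e -> S e !=set0.
  move=> e0; have hD : has_inf D.
    split; first by exists (rnorm ((phi x0)^-1 *: x0) ^+ 2);
      exists ((phi x0)^-1 *: x0) => //; rewrite phiZ mulVf.
    by exists 0 => _ [y _ ->]; rewrite exprn_ge0// rnorm_ge0.
  by have [_ [x px ->] lx] := inf_adherent e0 hD; exists x.
pose F := filter_from [set e : R | 0 < e] S.
have FF : ProperFilter F.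
  apply: filter_from_proper => //; apply: filter_from_filter; first by exists 1; exact: ltr01.
  move=> i j i0 j0; exists (Num.min i j); first by rewrite /= lt_min; apply/andP.
  move=> x [px lx]; split; split=> //; apply: lt_le_trans lx _.
    by rewrite lerD2l ge_min lexx.
  by rewrite lerD2l ge_min lexx orbT.
have cF : cauchy F.
  apply/cauchy_exP => _ /gt0_complexE [r r0 ->].
  have e0 : 0 < r ^+ 2 / 8 by rewrite divr_gt0 ?exprn_gt0.
  have [x Sx] := S_n0 _ e0; exists x; exists (r ^+ 2 / 8) => // y Sy.
  rewrite -ball_normE /= rnormE ltcR.
  rewrite -(@ltr_pXn2r _ 2) ?nnegrE ?rnorm_ge0 ?ltW//.
  have := S_sub Sx Sy; have : 0 < r ^+ 2 by rewrite exprn_gt0.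
  lra.
have cvF : cvg F := @cauchy_cvg H F FF cF.
move/(@cvg_ex H): cvF => [p Fp].
exists p => e e0.
have F1 : F (ball p e%:C) by apply: Fp; apply: nbhsx_ballx; rewrite ltcR.
have F2 : F (S e) by exists e.
have [x [Bx Sx]] := filter_ex (filterI F1 F2).
exists x => //; move: Bx; rewrite -ball_normE /=.
by rewrite rnormE ltcR.
Qed.

Lemma riesz : exists w, forall x, phi x = idot x w.
Proof.
have [h|/existsNP[x0 /eqP px0]] := pselect (forall x, phi x = 0).
  by exists 0 => x; rewrite h idot0r.
have [p hp] := S_near px0.
have M0 : 0 <= M.
  have xn : 0 < rnorm x0.
    rewrite lt_neqAle rnorm_ge0 andbT; apply/eqP => /esym/rnorm0_eq0 x00.
    by move: px0; rewrite x00 phi0 eqxx.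
  by rewrite -(pmulr_lge0 _ xn); apply: le_trans (phiM x0); exact: rnorm_ge0.
have pp : phi p = 1.
  apply/eqP; rewrite -subr_eq0; apply/eqP/rnorm0_eq0/le_anti.
  rewrite rnorm_ge0 andbT; apply: (small_le0 M0) => e e0.
  have [x [px _] lx] := hp e e0.
  rewrite -px -phiB; apply: le_trans (phiM _) _.
  by rewrite mulrC ler_wpM2r// ltW.
have pk k : phi k = 0 -> idot p k = 0.
  move=> k0; apply/rnorm0_eq0/le_anti; rewrite rnorm_ge0 andbT.
  apply: (@small_le0 _ _ (2 * rnorm k)); first by rewrite mulr_ge0// rnorm_ge0.
  move=> e e0.
  have m0 : 0 < Num.min e (e ^+ 2) by rewrite lt_min e0 exprn_gt0.
  have [x Sx lx] := hp _ m0.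
  have me : Num.min e (e ^+ 2) <= e by rewrite ge_min lexx.
  have me2 : Num.min e (e ^+ 2) <= e ^+ 2 by rewrite ge_min lexx orbT.
  have h1 : rnorm (idot x k) <= e * rnorm k.
    rewrite -(@ler_pXn2r _ 2) ?nnegrE ?mulr_ge0 ?rnorm_ge0 ?(ltW e0)//.
    rewrite exprMn; apply: le_trans (S_orth m0 Sx k0) _.
    by rewrite ler_wpM2r// exprn_ge0// rnorm_ge0.
  have h2 : rnorm (idot (p - x) k) <= e * rnorm k.
    apply: le_trans (rnorm_CS _ _) _; rewrite ler_wpM2r ?rnorm_ge0//.
    by rewrite ltW// (lt_le_trans lx).
  have -> : idot p k = idot x k + idot (p - x) k by rewrite idotBl addrC subrK.
  by apply: le_trans (rnormD _ _) _; lra.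
have p0 : p != 0 by apply/eqP => p0; move: pp; rewrite p0 phi0 => /esym/eqP; rewrite oner_eq0.
have n0 : idot p p != 0 by rewrite idot_norm sqrf_eq0 normr_eq0.
exists ((idot p p)^-1 *: p) => x.
have hc : Num.conj (idot p p) = idot p p by rewrite -idotC.
rewrite idotZr fmorphV /= hc.
have : idot p (x - phi x *: p) = 0 by apply: pk; rewrite phiB phiZ pp mulr1 subrr.
move=> /(congr1 Num.conj); rewrite -idotC conjC0 idotBl idotZl => /eqP.
by rewrite subr_eq0 => /eqP ->; rewrite mulrCA mulVf// mulr1.
Qed.
End Riesz.

Section BoundedOperators.
Variables (R : realType) (H : hilbertType R).
Local Notation C := R[i].
Implicit Types (x y : H).

Definition is_bounded_op (f : H -> H) : Prop := linear f /\ continuous f.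

Lemma bounded_opP (f : H -> H) : linear f ->
  continuous f <-> exists2 M, 0 <= M & forall x, rnorm (f x) <= M * rnorm x.
Proof.
move=> lf; pose isl := GRing.isLinear.Build C H H *:%R f lf.
pose g : {linear H -> H} := HB.pack f isl.
rewrite -[f]/(g : H -> H) -linear_bounded_continuous linear_boundedP; split.
  move=> /pinfty_ex_gt0 [M /gt0_complexE [r r0 ->] Mg].
  exists r => [|x]; first exact: ltW.
  by rewrite -lecR rmorphM /= -!rnormE.
move=> [M M0 h]; exists M%:C; split; first by rewrite ger0_real ?lecR.
move=> r /ltW Mr x; apply: (le_trans (y := M%:C * `|x|)).
  by rewrite !rnormE -rmorphM lecR.
by rewrite ler_wpM2r.
Qed.

Record bop := Bop { bop_fun :> H -> H; _ : `[< is_bounded_op bop_fun >] }.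

HB.instance Definition _ := [isSub for bop_fun].
HB.instance Definition _ := [Choice of bop by <:].

Definition bop_pred : {pred H -> H} := fun f => `[< is_bounded_op f >].

Lemma bop_submod : submod_closed bop_pred.
Proof.
split=> [|a f g /asboolP [lf cf] /asboolP [lg cg]]; apply/asboolP; split.
- by move=> a x y; change (0 = a *: (0 : H) + 0); rewrite scaler0 addr0.
- exact: cst_continuous.
- move=> b x y; change (a *: f (b *: x + y) + g (b *: x + y) =
    b *: (a *: f x + g x) + (a *: f y + g y)).
  rewrite lf lg !scalerDr !scalerA (mulrC a b).
  by rewrite addrACA.
- move=> x; apply: (@cvgD C H H _ _ (fun x => a *: f x) g); last exact: cg.
  by apply: cvgZr; exact: cf.
Qed.
HB.instance Definition _ := GRing.isSubmodClosed.Build C (H -> H) bop_pred bop_submod.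
HB.instance Definition _ := GRing.SubChoice_isSubLmodule.Build C (H -> H) bop_pred bop bop_submod.

End BoundedOperators.

Section OperatorNorm.
Variables (R : realType) (H : hilbertType R).
Local Notation C := R[i].
Implicit Types (x y : H) (f g h : bop H).

Lemma bop_linear f : linear f.
Proof. by case: f => f /= /asboolP[]. Qed.
Lemma bop_continuous f : continuous f.
Proof. by case: f => f /= /asboolP[]. Qed.
Lemma bopP f g : (forall x, f x = g x) -> f = g.
Proof. by move=> fg; apply/val_inj/funext. Qed.
Lemma bopDE f g x : (f + g) x = f x + g x. Proof. by []. Qed.
Lemma bopZE (a : C) f x : (a *: f) x = a *: f x. Proof. by []. Qed.
Lemma bopNE f x : (- f) x = - f x. Proof. by []. Qed.
Lemma bopBE f g x : (f - g) x = f x - g x. Proof. by []. Qed.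
Lemma bop0E x : (0 : bop H) x = 0. Proof. by []. Qed.
Lemma bop_map0 f : f 0 = 0.
Proof. by have := bop_linear f (-1) 0 0; rewrite scaler0 addr0 scaleN1r addNr. Qed.
Lemma bop_mapZ f (a : C) x : f (a *: x) = a *: f x.
Proof. by have := bop_linear f a x 0; rewrite bop_map0 !addr0. Qed.
Lemma bop_mapD f x y : f (x + y) = f x + f y.
Proof. by have := bop_linear f 1 x y; rewrite !scale1r. Qed.

Definition opnorm f : R :=
  sup [set r | exists2 x, `|x| <= 1 & r%:C = `|f x|].

Lemma opnorm_has_sup f : has_sup [set r | exists2 x, `|x| <= 1 & r%:C = `|f x|].
Proof.
split; first by exists 0, 0; rewrite ?normr0// bop_map0 normr0.
have /(bounded_opP (bop_linear f)) [M M0 fM] := @bop_continuous f.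
exists M => r [x x1]; rewrite rnormE => /complexI ->.
apply: le_trans (fM x) _; rewrite -[leRHS]mulr1 ler_wpM2l//.
by rewrite -lecR -rnormE.
Qed.

Lemma opnorm_ge0 f : 0 <= opnorm f.
Proof.
apply: sup_upper_bound; first exact: opnorm_has_sup.
by exists 0; rewrite ?normr0// bop_map0 normr0.
Qed.

Lemma opnorm_bound f x : rnorm (f x) <= opnorm f * rnorm x.
Proof.
have [->|x0] := eqVneq x 0; first by rewrite bop_map0 !rnorm0 mulr0.
have nx : 0 < rnorm x.
  by rewrite lt_neqAle rnorm_ge0 andbT; apply: contra_neq x0 => /esym/rnorm0_eq0.
have nxV : 0 <= (rnorm x)^-1 by rewrite invr_ge0 ltW.
rewrite -ler_pdivrMr//; apply: sup_upper_bound; first exact: opnorm_has_sup.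
exists ((rnorm x)^-1%:C *: x).
  rewrite rnormE (lecR _ 1) rnormZ rnorm_real//.
  by rewrite mulVf// gt_eqF.
rewrite rnormE bop_mapZ rnormZ rnorm_real//.
by rewrite mulrC.
Qed.

Lemma opnorm_le f M : 0 <= M -> (forall x, rnorm (f x) <= M * rnorm x) ->
  opnorm f <= M.
Proof.
move=> M0 fM; apply: ge_sup; first by case: (opnorm_has_sup f).
move=> r [x x1]; rewrite rnormE => /complexI ->.
apply: le_trans (fM x) _; rewrite -[leRHS]mulr1 ler_wpM2l//.
by rewrite -lecR -rnormE.
Qed.

Definition bop_norm f : C := (opnorm f)%:C.

Lemma bop_normD f g : bop_norm (f + g) <= bop_norm f + bop_norm g.
Proof.
rewrite -rmorphD lecR; apply: opnorm_le => [|x].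
  by rewrite addr_ge0 ?opnorm_ge0.
rewrite bopDE mulrDl; apply: le_trans (rnormD _ _) _.
by rewrite lerD ?opnorm_bound.
Qed.

Lemma bop_normZ (a : C) f : bop_norm (a *: f) = `|a| * bop_norm f.
Proof.
have le_Z (b : C) h : opnorm (b *: h) <= rnorm b * opnorm h.
  apply: opnorm_le => [|x]; first by rewrite mulr_ge0 ?rnorm_ge0 ?opnorm_ge0.
  by rewrite bopZE rnormZ -mulrA ler_wpM2l ?rnorm_ge0 ?opnorm_bound.
rewrite rnormE -rmorphM; congr _%:C; apply/le_anti; rewrite le_Z /=.
have [->|a0] := eqVneq a 0; first by rewrite rnorm0 mul0r opnorm_ge0.
have := le_Z a^-1 (a *: f); rewrite scalerA mulVf// scale1r => h.
apply: le_trans (ler_wpM2l (rnorm_ge0 a) h) _.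
by rewrite mulrA -rnormM mulfV// rnorm1 mul1r.
Qed.

Lemma bop_norm0_eq0 f : bop_norm f = 0 -> f = 0.
Proof.
move=> /(@complexI R) f0; apply: bopP => x; apply: rnorm0_eq0.
apply/le_anti; rewrite rnorm_ge0 andbT.
by apply: le_trans (opnorm_bound f x) _; rewrite f0 mul0r.
Qed.

HB.instance Definition _ :=
  Lmodule_isNormed.Build C (bop H) bop_normD bop_normZ bop_norm0_eq0.

Lemma bop_rnormE f : rnorm f = opnorm f.
Proof. by []. Qed.

Lemma bop_complete (F : set_system (bop H)) :
  ProperFilter F -> cauchy F -> cvg F.
Proof.
move=> FF /cauchyP Fc.
have Fc' (e : R) : 0 < e -> exists f, F [set g | opnorm (f - g) < e].
  move=> e0; have e0' : 0 < e%:C by rewrite ltcR.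
  have [f Ff] := Fc _ e0'.
  exists f; apply: filterS Ff => g; rewrite -ball_normE /= rnormE ltcR.
  by rewrite bop_rnormE.
have Fx x : cvg ((fun f => f x) @ F).
  apply: (@cauchy_cvg H); apply/cauchy_exP => _ /gt0_complexE[e e0 ->].
  have nx0 : 0 < rnorm x + 1 by rewrite ltr_wpDl ?rnorm_ge0.
  have [f Ff] := Fc' _ (divr_gt0 e0 nx0).
  exists (f x); rewrite /= /nbhs /=; apply: filterS Ff => g /= fg.
  rewrite -ball_normE /= rnormE ltcR -bopBE.
  apply: le_lt_trans (opnorm_bound _ _) _.
  have := opnorm_ge0 (f - g); move: fg; rewrite ltr_pdivlMr// => fg ?.
  by apply: le_lt_trans fg; rewrite ler_wpM2l// lerDl.
pose l x := lim ((fun f => f x) @ F).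
have lP x (e : R) : 0 < e -> F [set f | rnorm (l x - f x) < e].
  move=> e0; have := Fx x (ball (l x) e%:C).
  move=> /(_ (nbhsx_ballx _ _ _)); rewrite ltcR => /(_ e0).
  rewrite /= /nbhs /=; apply: filterS => f /=.
  by rewrite -ball_normE /= rnormE ltcR.
have le_l (f : bop H) (e : R) : F [set g | opnorm (f - g) < e] ->
    forall x, rnorm (f x - l x) <= e * rnorm x.
  move=> Ff x; rewrite -subr_le0; apply: (@small_le0 _ _ 1) => // d d0.
  have [g [/= fg lg]] := filter_ex (filterI Ff (lP x d d0)).
  have -> : f x - l x = (f - g) x - (l x - g x).
    by rewrite bopBE opprB addrA subrK.
  have := opnorm_bound (f - g) x.
  have := rnormD ((f - g) x) (- (l x - g x)); rewrite rnormN.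
  have := rnorm_ge0 x; nra.
have ll : linear l.
  move=> a x y; apply/eqP; rewrite -subr_eq0; apply/eqP/rnorm0_eq0/le_anti.
  rewrite rnorm_ge0 andbT.
  apply: (@small_le0 _ _ (1 + rnorm a + 1)).
    by rewrite addr_ge0// addr_ge0// rnorm_ge0.
  move=> e e0.
  have [f [/= h1 [/= h2 h3]]] := filter_ex
    (filterI (lP (a *: x + y) e e0) (filterI (lP x e e0) (lP y e e0))).
  have -> : l (a *: x + y) - (a *: l x + l y) =
      (l (a *: x + y) - f (a *: x + y)) - (a *: (l x - f x) + (l y - f y)).
    by rewrite bop_linear scalerBr addrACA -opprD opprB addrA subrK.
  have := rnormD (l (a *: x + y) - f (a *: x + y))
    (- (a *: (l x - f x) + (l y - f y))); rewrite rnormN.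
  have := rnormD (a *: (l x - f x)) (l y - f y); rewrite rnormZ.
  have := rnorm_ge0 a; nra.
have lb : continuous l.
  apply/(bounded_opP ll); have [f Ff] := Fc' 1 ltr01.
  exists (opnorm f + 1) => [|x]; first by rewrite addr_ge0// opnorm_ge0.
  have -> : l x = f x - (f x - l x) by rewrite opprB addrC subrK.
  apply: le_trans (rnormD _ _) _; rewrite rnormN mulrDl lerD//.
    exact: opnorm_bound.
  exact: le_l.
have lB : `[< is_bounded_op l >] by apply/asboolP.
apply/(@cvg_ex (bop H)); exists (Bop lB).
apply/cvgrPdist_lt => _ /gt0_complexE[e e0 ->].
have e3 : 0 < e / 3 by rewrite divr_gt0.
have [f Ff] := Fc' _ e3.
rewrite near_simpl; apply: filterS (Ff) => g /= fg.
rewrite rnormE ltcR bop_rnormE.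
apply: (@le_lt_trans _ _ (e / 3 + e / 3)); last lra.
apply: opnorm_le => [|x]; first lra.
rewrite bopBE /=.
have -> : l x - g x = (f - g) x - (f x - l x).
  by rewrite bopBE opprB [RHS]addrC addrA subrK.
have := rnormD ((f - g) x) (- (f x - l x)); rewrite rnormN.
have := le_l _ _ Ff x; have := opnorm_bound (f - g) x.
have := rnorm_ge0 x; nra.
Qed.

HB.instance Definition _ := Uniform_isComplete.Build (bop H) bop_complete.

End OperatorNorm.

Section OperatorAlgebra.
Variables (R : realType) (H : hilbertType R).
Local Notation C := R[i].
Implicit Types (x y : H) (f g h : bop H).

Lemma bop_id_subproof : `[< is_bounded_op (@idfun H) >].
Proof. by apply/asboolP; split=> [a x y //|x]; exact: cvg_id. Qed.
Definition bop_id : bop H := Bop bop_id_subproof.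

Lemma bop_comp_subproof f g : `[< is_bounded_op (f \o g) >].
Proof.
apply/asboolP; split=> [a x y|x]; first by rewrite /= !bop_linear.
by apply: continuous_comp; exact: bop_continuous.
Qed.
Definition bop_comp f g : bop H := Bop (bop_comp_subproof f g).

Lemma adjoint_ex f : exists g, forall x y, idot (f x) y = idot x (g y).
Proof.
have ex y : exists w, forall x, idot (f x) y = idot x w.
  apply: (@riesz R H (fun x => idot (f x) y) (opnorm f * rnorm y)).
    by move=> a x z; rewrite bop_linear idotDl idotZl.
  move=> x; apply: le_trans (rnorm_CS _ _) _.
  by rewrite mulrAC ler_wpM2r ?rnorm_ge0 ?opnorm_bound.
pose k y := projT1 (cid (ex y)).
have kP x y : idot (f x) y = idot x (k y) by rewrite /k; case: cid.
have kl : linear k.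
  move=> a y z; apply: idot_inj => x.
  by rewrite -kP !idotDr !idotZr -!kP.
have kb : `[< is_bounded_op k >].
  apply/asboolP; split=> //; apply/(bounded_opP kl).
  exists (opnorm f) => [|y]; first exact: opnorm_ge0.
  have [->|ky0] := eqVneq (rnorm (k y)) 0.
    by rewrite mulr_ge0 ?opnorm_ge0 ?rnorm_ge0.
  have ky : 0 < rnorm (k y) by rewrite lt_neqAle eq_sym ky0 rnorm_ge0.
  rewrite -(ler_pM2r ky) -expr2 -rnorm_idotE -kP.
  apply: le_trans (rnorm_CS _ _) _; rewrite mulrAC ler_wpM2r ?rnorm_ge0//.
  exact: opnorm_bound.
by exists (Bop kb).
Qed.

Definition adjoint f : bop H := projT1 (cid (adjoint_ex f)).

Lemma adjointP f x y : idot (f x) y = idot x (adjoint f y).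
Proof. by rewrite /adjoint; case: cid. Qed.

Lemma bop_compA : associative bop_comp.
Proof. by move=> f g h; apply: bopP. Qed.
Lemma bop_comp_linearl h (a : C) f g :
  bop_comp (a *: f + g) h = a *: bop_comp f h + bop_comp g h.
Proof. by apply: bopP. Qed.
Lemma bop_comp_linearr h (a : C) f g :
  bop_comp h (a *: f + g) = a *: bop_comp h f + bop_comp h g.
Proof. by apply: bopP => x /=; rewrite bop_linear. Qed.
Lemma adjoint_conjlinear (a : C) f g :
  adjoint (a *: f + g) = Num.conj a *: adjoint f + adjoint g.
Proof.
apply: bopP => y; apply: idot_inj => x.
rewrite -adjointP !(bopDE, bopZE) idotDl idotDr idotZl idotZr conjCK.
by rewrite -!adjointP.
Qed.
Lemma adjointM f g : adjoint (bop_comp f g) = bop_comp (adjoint g) (adjoint f).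
Proof.
by apply: bopP => y; apply: idot_inj => x; rewrite -adjointP /= -!adjointP.
Qed.
Lemma adjointK : involutive adjoint.
Proof.
move=> f; apply: bopP => y; apply: idot_inj => x.
by rewrite -adjointP idotC -adjointP -idotC.
Qed.

HB.instance Definition _ := Lmodule_isStarAlgebra.Build C (bop H)
  bop_compA bop_comp_linearl bop_comp_linearr adjoint_conjlinear adjointM
  adjointK.

Lemma opnormM f g : opnorm (f ** g) <= opnorm f * opnorm g.
Proof.
apply: opnorm_le => [|x]; first by rewrite mulr_ge0 ?opnorm_ge0.
apply: le_trans (opnorm_bound f (g x)) _.
by rewrite -mulrA ler_wpM2l ?opnorm_ge0 ?opnorm_bound.
Qed.

Lemma opnorm_sq_le f : opnorm f ^+ 2 <= opnorm (f^** ** f).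
Proof.
have n0 := opnorm_ge0 (f^** ** f).
have le_s : opnorm f <= Num.sqrt (opnorm (f^** ** f)).
  apply: opnorm_le => [|x]; first exact: sqrtr_ge0.
  rewrite -(@ler_pXn2r _ 2) ?nnegrE ?mulr_ge0 ?sqrtr_ge0 ?rnorm_ge0//.
  rewrite exprMn sqr_sqrtr// -rnorm_idotE adjointP.
  apply: le_trans (rnorm_CS _ _) _.
  have := opnorm_bound (f^** ** f) x.
  have := rnorm_ge0 x; rewrite -[bop_fun (f^** ** f) x]/(adjoint f (f x)); nra.
have := opnorm_ge0 f; rewrite -(sqr_sqrtr n0); nra.
Qed.

Lemma opnorm_star_le f : opnorm f <= opnorm f^**.
Proof.
have [f0|f0] := leP (opnorm f) 0; first exact: le_trans (opnorm_ge0 _).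
rewrite -(ler_pM2r f0) -expr2; apply: le_trans (opnorm_sq_le f) _.
exact: opnormM.
Qed.

Lemma bop_cstar_normM f g : `|f ** g| <= `|f| * `|g|.
Proof. by rewrite !rnormE -rmorphM lecR; exact: opnormM. Qed.

Lemma bop_cstar_norm f : `|f^** ** f| = `|f| ^+ 2.
Proof.
rewrite !rnormE -real_complexX2; congr _%:C; apply/le_anti/andP; split.
  have := opnormM f^** f; have := opnorm_star_le f^**; rewrite starK.
  rewrite !bop_rnormE; have := opnorm_ge0 f; nra.
exact: opnorm_sq_le.
Qed.

HB.instance Definition _ :=
  isCStarAlgebra.Build R (bop H) bop_cstar_normM bop_cstar_norm.
End OperatorAlgebra.

Section Triples.
Variable C : numClosedFieldType.
Implicit Types A B : starAlgType C.

Definition is_subspace (V : lmodType C) (S : set V) : Prop :=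
  S 0 /\ forall (a : C) x y, S x -> S y -> S (a *: x + y).

(* Morphisms between subspaces are represented by functions on the ambient
   spaces whose values outside the subspace are irrelevant. *)
Definition linear_on (V W : lmodType C) (S : set V) (f : V -> W) : Prop :=
  forall (a : C) x y, S x -> S y -> f (a *: x + y) = a *: f x + f y.

Definition tprod A (x y z : A) : A := x ** y^** ** z.

Definition jprod A (a b c : A) : A := 2^-1 *: (tprod a b c + tprod c b a).

Definition tro_hom A B (S : set A) (T : set B) (f : A -> B) : Prop :=
  [/\ set_fun S T f, linear_on S f
    & forall x y z, S x -> S y -> S z ->
        f (tprod x y z) = tprod (f x) (f y) (f z)].

Definition jb_hom A B (S : set A) (T : set B) (f : A -> B) : Prop :=
  [/\ set_fun S T f, linear_on S f
    & forall x y z, S x -> S y -> S z ->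
        f (jprod x y z) = jprod (f x) (f y) (f z)].

Definition tro_iso A B (S : set A) (T : set B) : Prop :=
  exists2 f : A -> B, tro_hom S T f & set_bij S T f.

Definition jb_iso A B (S : set A) (T : set B) : Prop :=
  exists2 f : A -> B, jb_hom S T f & set_bij S T f.

Definition has_dim (V : lmodType C) (S : set V) (m : nat) : Prop :=
  exists b : 'I_m -> V,
    [/\ forall i, S (b i),
        forall c : 'I_m -> C, \sum_i c i *: b i = 0 -> forall i, c i = 0
      & forall x, S x -> exists c : 'I_m -> C, x = \sum_i c i *: b i].

End Triples.

Section SpinFactors.
Variable R : realType.
Implicit Types (A : cstarAlgType R) (H K : hilbertType R).

Definition is_JCstar_triple A (Z : set A) : Prop :=
  [/\ is_subspace Z, closed Z
    & forall a b c, Z a -> Z b -> Z c -> Z (jprod a b c)].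

Definition is_TRO H (T : set (bop H)) : Prop :=
  [/\ is_subspace T, closed T
    & forall x y z, T x -> T y -> T z -> T (tprod x y z)].

(* [s] lists the elements other than [id]. *)
Definition is_spin_system H (k : nat) (s : 'I_k -> bop H) : Prop :=
  [/\ (2 <= k)%N, forall i, (s i)^** = s i
    & forall i j, s i ** s j + s j ** s i = (2 * (i == j)%:R) *: bop_id H].

Definition spin_span H (k : nat) (s : 'I_k -> bop H) : set (bop H) :=
  [set x | exists (a : R[i]) (c : 'I_k -> R[i]),
     x = a *: bop_id H + \sum_i c i *: s i].

Definition is_spin_factor A (Z : set A) : Prop :=
  is_JCstar_triple Z /\
  exists H (k : nat) (s : 'I_k -> bop H),
    is_spin_system s /\ jb_iso Z (spin_span s).

Definition generates_TRO H (X T : set (bop H)) : Prop :=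
  X `<=` T /\ forall S : set (bop H), is_TRO S -> X `<=` S -> T `<=` S.

Definition is_universal_TRO A (Z : set A) H (T : set (bop H))
    (rho : A -> bop H) : Prop :=
  [/\ is_TRO T, jb_hom Z T rho, generates_TRO (rho @` Z) T
    & forall K (S : set (bop K)) (alpha : A -> bop K),
        is_TRO S -> jb_hom Z S alpha ->
        exists2 phi : bop H -> bop K, tro_hom T S phi
          & forall z, Z z -> alpha z = phi (rho z)].

End SpinFactors.

(* Main.v *)
Require Import Defs.
From HB Require Import structures.
From mathcomp Require Import all_boot all_order all_algebra complex.
From mathcomp Require Import all_classical all_reals.
From mathcomp Require Import topology normedtype.
From mathcomp Require Import ring lra.

Set Implicit Arguments.
Unset Strict Implicit.
Unset Printing Implicit Defensive.

Import Order.TTheory GRing.Theory Num.Theory.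
Import numFieldNormedType.Exports.

Local Open Scope classical_set_scope.
Local Open Scope ring_scope.
Local Open Scope complex_scope.

(* If alpha is a triple homomorphism of Z into a TRO and v = alpha(id), then
   t_i = alpha(s_i) v* are self-adjoint anticommuting square roots of the
   projection v v*, and alpha(s_i) = t_i v.  The TRO generated by alpha(Z) is
   thus spanned by the 2^k elements t_{i1} ... t_{ir} v with i1 < ... < ir, and
   a triple product of these is, up to a sign that does not depend on alpha,
   another one of them.  Hence whenever the 2^k elements are linearly
   independent for some homomorphism, their span is universal, and it is
   determined up to isomorphism.  Independence holds as soon as a grading
   operator anticommutes with all t_i: the monomials are then joint
   eigenvectors with pairwise different systems of eigenvalues.  On H (+) H the
   elements s_i (+) -s_i are graded by the flip, which gives existence.
   Block matrices provide 2n+1 Clifford generators in M_{2^n}; leaving one of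
   them out to serve as grading, or pairing t_i with -t_i and grading by the
   flip, gives independent monomials in M_{2^n} and in M_{2^n} (+) M_{2^n},
   which span by a dimension count. *)

(** * Bilinearity of the product and conjugate linearity of the star *)

Section StarAlgebraTheory.
Variables (C : numClosedFieldType) (A : starAlgType C).
Implicit Types (x y z : A) (a : C).

Lemma smulDl x y z : (x + y) ** z = x ** z + y ** z.
Proof. by have := smul_linearl z 1 x y; rewrite !scale1r. Qed.
Lemma smulDr x y z : z ** (x + y) = z ** x + z ** y.
Proof. by have := smul_linearr z 1 x y; rewrite !scale1r. Qed.
Lemma smul0l x : 0 ** x = 0.
Proof. by apply: (addrI (0 ** x)); rewrite -smulDl !addr0. Qed.
Lemma smul0r x : x ** 0 = 0.
Proof. by apply: (addrI (x ** 0)); rewrite -smulDr !addr0. Qed.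
Lemma smulZl a x y : (a *: x) ** y = a *: (x ** y).
Proof. by have := smul_linearl y a x 0; rewrite smul0l !addr0. Qed.
Lemma smulZr a x y : x ** (a *: y) = a *: (x ** y).
Proof. by have := smul_linearr x a y 0; rewrite smul0r !addr0. Qed.
Lemma smulNl x y : (- x) ** y = - (x ** y).
Proof. by rewrite -scaleN1r smulZl scaleN1r. Qed.
Lemma smulNr x y : x ** (- y) = - (x ** y).
Proof. by rewrite -scaleN1r smulZr scaleN1r. Qed.
Lemma starD x y : (x + y)^** = x^** + y^**.
Proof. by have := star_conjlinear 1 x y; rewrite conjC1 !scale1r. Qed.
Lemma star0 : (0 : A)^** = 0.
Proof. by apply: (addrI (0 : A)^**); rewrite -starD !addr0. Qed.
Lemma starZ a x : (a *: x)^** = Num.conj a *: x^**.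
Proof. by have := star_conjlinear a x 0; rewrite star0 !addr0. Qed.
Lemma starN x : (- x)^** = - x^**.
Proof. by rewrite -scaleN1r starZ rmorphN rmorph1 scaleN1r. Qed.

Variables (I : finType) (X : I -> A).

Lemma smul_suml (c : I -> C) y :
  (\sum_i c i *: X i) ** y = \sum_i c i *: (X i ** y).
Proof.
rewrite (big_morph (fun x => x ** y) (fun x x' => smulDl x x' y) (smul0l y)).
by apply: eq_bigr => i _; rewrite smulZl.
Qed.

Lemma smul_sumr (c : I -> C) y :
  y ** (\sum_i c i *: X i) = \sum_i c i *: (y ** X i).
Proof.
rewrite (big_morph (smul y) (fun x x' => smulDr x x' y) (smul0r y)).
by apply: eq_bigr => i _; rewrite smulZr.
Qed.

Lemma star_sum (c : I -> C) :
  (\sum_i c i *: X i)^** = \sum_i Num.conj (c i) *: (X i)^**.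
Proof.
rewrite (big_morph (@star C A) starD star0).
by apply: eq_bigr => i _; rewrite starZ.
Qed.

End StarAlgebraTheory.

(** * Spans of finite families and linear extension from independent ones *)

Section FiniteFamilies.
Variables (C : numClosedFieldType) (I : finType).

Definition fam_span (V : lmodType C) (X : I -> V) : set V :=
  [set x | exists c : I -> C, x = \sum_i c i *: X i].

Definition lin_indep (V : lmodType C) (X : I -> V) : Prop :=
  forall c : I -> C, \sum_i c i *: X i = 0 -> forall i, c i = 0.

Lemma fam_span_mem (V : lmodType C) (X : I -> V) i : fam_span X (X i).
Proof.
exists (fun j => (j == i)%:R).
by rewrite (bigD1 i)//= eqxx scale1r big1 ?addr0// => j /negbTE ->; rewrite scale0r.
Qed.

Lemma fam_spanZD (V : lmodType C) (X : I -> V) a x y :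
  fam_span X x -> fam_span X y -> fam_span X (a *: x + y).
Proof.
move=> [c ->] [d ->]; exists (fun i => a * c i + d i).
rewrite scaler_sumr -big_split; apply: eq_bigr => i _.
by rewrite scalerA scalerDl.
Qed.

Lemma fam_span0 (V : lmodType C) (X : I -> V) : fam_span X 0.
Proof. by exists (fun=> 0); rewrite big1// => i _; rewrite scale0r. Qed.

Lemma fam_span_subspace (V : lmodType C) (X : I -> V) : is_subspace (fam_span X).
Proof. by split; [exact: fam_span0 | exact: fam_spanZD]. Qed.

Lemma subspace_sum (V : lmodType C) (S : set V) (J : Type) (r : seq J)
    (c : J -> C) (X : J -> V) :
  is_subspace S -> (forall i, S (X i)) -> S (\sum_(i <- r) c i *: X i).
Proof.
move=> [S0 SZD] SX; elim: r => [|i r IH]; first by rewrite big_nil.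
by rewrite big_cons; apply: SZD.
Qed.

Lemma subspace_fam_span (V : lmodType C) (S : set V) (X : I -> V) :
  is_subspace S -> (forall i, S (X i)) -> fam_span X `<=` S.
Proof. by move=> Ssub SX _ [c ->]; exact: subspace_sum. Qed.

Lemma linear_on_sum (V W : lmodType C) (S : set V) (f : V -> W) (J : Type)
    (r : seq J) (c : J -> C) (X : J -> V) :
  is_subspace S -> linear_on S f -> (forall i, S (X i)) ->
  f (\sum_(i <- r) c i *: X i) = \sum_(i <- r) c i *: f (X i).
Proof.
move=> Ssub fl SX; elim: r => [|i r IH].
  rewrite !big_nil; have := fl (-1) 0 0 Ssub.1 Ssub.1.
  by rewrite !scaleN1r !addNr.
by rewrite !big_cons fl ?IH//; exact: subspace_sum.
Qed.

Lemma lin_indep_eq (V : lmodType C) (X : I -> V) (c d : I -> C) :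
  lin_indep X -> \sum_i c i *: X i = \sum_i d i *: X i -> c = d.
Proof.
move=> Xfree /eqP; rewrite -subr_eq0 -sumrB => /eqP cd; apply/funext => i.
apply/eqP; rewrite -subr_eq0; apply/eqP.
apply: (Xfree (fun i => c i - d i)); rewrite -[RHS]cd.
by apply: eq_bigr => j _; rewrite scalerBl.
Qed.

(** Coordinates are chosen, with default 0 off the span; independence of [X] makes the choice
    unique. *)
Definition fam_coord (V : lmodType C) (X : I -> V) (x : V) : {ffun I -> C} :=
  xget 0 [set c : {ffun I -> C} | x = \sum_i c i *: X i].

Definition fam_ext (V W : lmodType C) (X : I -> V) (Y : I -> W) (x : V) : W :=
  \sum_i fam_coord X x i *: Y i.

Lemma fam_extE (V W : lmodType C) (X : I -> V) (Y : I -> W) (c : I -> C) :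
  lin_indep X -> fam_ext X Y (\sum_i c i *: X i) = \sum_i c i *: Y i.
Proof.
move=> Xfree; apply: eq_bigr => i _; congr (_ *: _).
rewrite /fam_coord; case: xgetP => [d _ /(lin_indep_eq Xfree) -> //|].
move=> /(_ [ffun i => c i]) []; apply: eq_bigr => j _; by rewrite ffunE.
Qed.

Lemma fam_ext_basis (V W : lmodType C) (X : I -> V) (Y : I -> W) i :
  lin_indep X -> fam_ext X Y (X i) = Y i.
Proof.
move=> Xfree; have [c Xi] := fam_span_mem X i.
have e : c = (fun j => (j == i)%:R).
  apply: (lin_indep_eq Xfree); rewrite -Xi (bigD1 i)//= eqxx scale1r.
  by rewrite big1 ?addr0// => j /negbTE ->; rewrite scale0r.
rewrite Xi fam_extE// e (bigD1 i)//= eqxx scale1r.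
by rewrite big1 ?addr0// => j /negbTE ->; rewrite scale0r.
Qed.

Lemma fam_ext_linear (V W : lmodType C) (X : I -> V) (Y : I -> W) :
  lin_indep X -> linear_on (fam_span X) (fam_ext X Y).
Proof.
move=> Xfree a _ _ [c ->] [d ->]; rewrite !fam_extE// !scaler_sumr -!big_split /=.
transitivity (fam_ext X Y (\sum_i (a * c i + d i) *: X i)).
  by congr (fam_ext _ _ _); apply: eq_bigr => i _; rewrite scalerA scalerDl.
by rewrite fam_extE//; apply: eq_bigr => i _; rewrite scalerA scalerDl.
Qed.

Lemma tprod_sum (A : starAlgType C) (X : I -> A) (c d e : I -> C) :
  tprod (\sum_i c i *: X i) (\sum_i d i *: X i) (\sum_i e i *: X i) =
  \sum_i c i *: \sum_j Num.conj (d j) *: \sum_l e l *: tprod (X i) (X j) (X l).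
Proof.
rewrite /tprod -smulA smul_suml; apply: eq_bigr => i _; congr (_ *: _).
rewrite star_sum smul_suml smul_sumr; apply: eq_bigr => j _; congr (_ *: _).
by rewrite !smul_sumr; apply: eq_bigr => l _; rewrite smulA.
Qed.

Lemma fam_span_tprod (A : starAlgType C) (X : I -> A) x y z :
  (forall i j l, fam_span X (tprod (X i) (X j) (X l))) ->
  fam_span X x -> fam_span X y -> fam_span X z -> fam_span X (tprod x y z).
Proof.
move=> Xt [c ->] [d ->] [e ->]; rewrite tprod_sum.
by do 3![apply: subspace_sum => [|?]; first exact: fam_span_subspace].
Qed.

(** The triple product is linear in its outer arguments and conjugate-linear in the middle one.
    Agreement on the family therefore suffices, once products of its members stay in the span, where
    the extension is linear. *)
Lemma fam_ext_tro_hom (A B : starAlgType C) (X : I -> A) (Y : I -> B) (T : set B) :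
  lin_indep X -> is_subspace T -> (forall i, T (Y i)) ->
  (forall i j l, fam_span X (tprod (X i) (X j) (X l))) ->
  (forall i j l, fam_ext X Y (tprod (X i) (X j) (X l)) =
                 tprod (Y i) (Y j) (Y l)) ->
  tro_hom (fam_span X) T (fam_ext X Y).
Proof.
move=> Xfree Tsub TY Xt XY.
have Ssub := fam_span_subspace X.
have lf := fam_ext_linear Y Xfree.
split=> // [x _|x y z [c ->] [d ->] [e ->]]; first exact: subspace_sum.
rewrite tprod_sum !fam_extE// tprod_sum (linear_on_sum _ _ Ssub lf); last first.
  by move=> i; do 2![apply: subspace_sum => // ?].
apply: eq_bigr => i _; congr (_ *: _); rewrite (linear_on_sum _ _ Ssub lf); last first.
  by move=> j; apply: subspace_sum.
apply: eq_bigr => j _; congr (_ *: _); rewrite (linear_on_sum _ _ Ssub lf)//.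
by apply: eq_bigr => l _; rewrite XY.
Qed.

Lemma fam_ext_bij (V W : lmodType C) (X : I -> V) (Y : I -> W) :
  lin_indep X -> lin_indep Y ->
  set_bij (fam_span X) (fam_span Y) (fam_ext X Y).
Proof.
move=> Xfree Yfree; split.
- by move=> x [c ->]; rewrite fam_extE//; exists c.
- move=> x y; rewrite !inE => -[c ->] [d ->]; rewrite !fam_extE//.
  by move=> /(lin_indep_eq Yfree) ->.
- by move=> _ [c ->]; exists (\sum_i c i *: X i); [exists c | rewrite fam_extE].
Qed.

End FiniteFamilies.

(** * Words in anticommuting symmetries and their normal forms *)

Section SpinFamilies.
Variables (C : numClosedFieldType) (k : nat).
Local Notation I := 'I_k.

(** What a triple homomorphism on a spin span provides: a partial isometry [v] whose range
    projection [v ** v^**] serves as unit for the symmetries [t i], in an algebra that may have no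
    unit. *)
Record spin_family (A : starAlgType C) (v : A) (t : I -> A) : Prop := SpinFamily {
  sf_pisom : tprod v v v = v;
  sf_star : forall i, (t i)^** = t i;
  sf_unit : forall i, (v ** v^**) ** t i = t i;
  sf_sqr : forall i, t i ** t i = v ** v^**;
  sf_anti : forall i j, i != j -> t i ** t j = - (t j ** t i);
}.

Definition word (A : starAlgType C) (v : A) (t : I -> A) (w : seq I) : A :=
  foldr (fun i x => t i ** x) v w.

(** The symmetric difference with the singleton of [i]: a new letter is inserted, a repeated one
    cancels. *)
Definition toggle (i : I) (S : {set I}) : {set I} :=
  [set j | (j \in S) (+) (j == i)]%SET.

(** For [i] in [l], the parity of the number of elements of [S] standing before [i]: the sign picked
    up when [t i] moves to its sorted place. *)
Fixpoint move_sign (i : I) (S : {set I}) (l : seq I) : bool :=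
  if l is j :: l' then
    if j == i then false else (j \in S) (+) move_sign i S l'
  else false.

Definition sorted_word (S : {set I}) : seq I := [seq i <- enum I | i \in S].

Lemma sorted_wordE i S : (i \in sorted_word S) = (i \in S).
Proof. by rewrite /sorted_word (mem_filter (mem S)) mem_enum andbT. Qed.

Lemma sorted_word_uniq S : uniq (sorted_word S).
Proof. by apply: filter_uniq; exact: enum_uniq. Qed.

(** Sign and index set are computed from the letters alone; this independence of the algebra is what
    allows two spin families to be compared. *)
Fixpoint normal_form (w : seq I) : bool * {set I} :=
  if w is i :: w' then
    let: (b, U) := normal_form w' in
    (b (+) move_sign i U (enum I), toggle i U)
  else (false, finset.set0).

Definition monomial (A : starAlgType C) (v : A) (t : I -> A) (S : {set I}) : A :=
  word v t (sorted_word S).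

Section Words.
Variables (A : starAlgType C) (v : A) (t : I -> A).
Hypothesis vt : spin_family v t.
Let p := v ** v^**.

Lemma pisom_word w : p ** word v t w = word v t w.
Proof.
case: w => [|i w] /=; first exact: sf_pisom vt.
by rewrite smulA sf_unit.
Qed.

(** [t i] is carried past the letters of [S] that precede it, one sign each, until it is inserted at
    its place or cancels against the copy found there. *)
Lemma word_move (i : I) (S : {set I}) l : uniq l -> i \in l ->
  t i ** word v t [seq j <- l | j \in S] =
  (-1) ^+ move_sign i S l *: word v t [seq j <- l | j \in toggle i S].
Proof.
elim: l => // j l IH /= /andP[jl ul]; rewrite inE.
have [eij _ | ij /= il] := eqVneq i j; first subst j.
  (* The list has no repetition, so toggling its head leaves the tail unchanged. *)
  have -> : [seq x <- l | x \in toggle i S] = [seq x <- l | x \in S].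
    apply: eq_in_filter => x xl; rewrite inE.
    have [xi|] := eqVneq x i; last by rewrite addbF.
    by rewrite -xi xl in jl.
  rewrite inE eqxx /= scale1r addbT; case: (i \in S) => //=.
  by rewrite smulA (sf_sqr vt) pisom_word.
have toggle_j : (j \in toggle i S) = (j \in S) by rewrite inE eq_sym (negbTE ij) addbF.
rewrite toggle_j; case: (j \in S) => /=; last exact: IH.
rewrite smulA (sf_anti vt)// smulNl -smulA IH// smulZr -scaleN1r scalerA.
by rewrite -(signr_addb C true).
Qed.

Lemma word_normal_form w :
  word v t w = (-1) ^+ (normal_form w).1 *: monomial v t (normal_form w).2.
Proof.
elim: w => [|i w /= ->].
  rewrite /= scale1r /monomial /sorted_word (@eq_filter _ _ pred0) ?filter_pred0//.
  by move=> i; rewrite inE.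
case: (normal_form w) => b S /=; rewrite smulZr word_move ?enum_uniq ?mem_enum//.
by rewrite scalerA signr_addb.
Qed.

Lemma word_word w w' x : word (word x t w') t w = word x t (w ++ w').
Proof. by rewrite /word foldr_cat. Qed.

Lemma word_smul w x y : word (x ** y) t w = word x t w ** y.
Proof. by elim: w => //= i w ->; rewrite smulA. Qed.

(** Self-adjoint letters pass one at a time from the starred factor to the right factor, which
    reverses their order. [word y t [::]] is just [y], seen as a word ready to absorb them. *)
Lemma star_word w y : (word v t w)^** ** word y t [::] = v^** ** word y t (rev w).
Proof.
elim: w y => [|i w IH] y //=.
rewrite starM (sf_star vt) -smulA rev_cons -cats1 -word_word /=.
exact: IH.
Qed.

(** Between [w1] and the reversed [w2] only the projection [v ** v^**] remains, and it fixes every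
    word. *)
Lemma tprod_word w1 w2 w3 :
  tprod (word v t w1) (word v t w2) (word v t w3) =
  word v t (w1 ++ rev w2 ++ w3).
Proof.
rewrite /tprod -smulA -[word v t w3]/(word (word v t w3) t [::]) star_word word_word.
rewrite smulA -word_smul -[LHS]word_smul.
by rewrite pisom_word word_word.
Qed.

Lemma word_span w : fam_span (monomial v t) (word v t w).
Proof.
rewrite word_normal_form -[X in fam_span _ X]addr0.
by apply: fam_spanZD; [exact: fam_span_mem | exact: fam_span0].
Qed.

Lemma monomial_span_tprod S1 S2 S3 :
  fam_span (monomial v t)
    (tprod (monomial v t S1) (monomial v t S2) (monomial v t S3)).
Proof. rewrite tprod_word; exact: word_span. Qed.

Lemma word_eq0 w : word v t w = 0 -> v = 0.
Proof.
elim: w => //= i w IH /(congr1 (smul (t i))).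
by rewrite smulA (sf_sqr vt) pisom_word smul0r.
Qed.

End Words.

(** Both words have the same normal form, hence the same sign and the same index set. *)
Lemma fam_ext_word (A B : starAlgType C) (v : A) (t : I -> A) (v' : B)
    (t' : I -> B) w :
  spin_family v t -> spin_family v' t' -> lin_indep (monomial v t) ->
  fam_ext (monomial v t) (monomial v' t') (word v t w) = word v' t' w.
Proof.
move=> vt vt' free; rewrite (word_normal_form vt) (word_normal_form vt').
(* The added 0 gives the argument the shape [a *: x + y] of [linear_on]. *)
rewrite -[X in fam_ext _ _ X]addr0 fam_ext_linear//; last 2 first.
- exact: fam_span_mem.
- exact: fam_span0.
rewrite fam_ext_basis// -[RHS]addr0; congr (_ + _).
have := fam_extE (monomial v' t') (fun=> 0) free.
by rewrite !big1// => S _; rewrite scale0r.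
Qed.

Lemma monomial_tro_hom (A B : starAlgType C) (v : A) (t : I -> A)
    (v' : B) (t' : I -> B) (T : set B) :
  spin_family v t -> spin_family v' t' -> lin_indep (monomial v t) ->
  is_subspace T -> (forall S, T (monomial v' t' S)) ->
  tro_hom (fam_span (monomial v t)) T (fam_ext (monomial v t) (monomial v' t')).
Proof.
move=> vt vt' free Tsub Tm; apply: fam_ext_tro_hom => // S1 S2 S3.
  exact: monomial_span_tprod.
by rewrite !tprod_word// fam_ext_word.
Qed.

(** Composing the operators 1 + (-1)^[i in S0] D_i over all i gives a map [q] that kills [X S] for S
    other than S0 and multiplies [X S0] by 2^k. Applied to a linear relation it isolates the
    coefficient of [X S0]. *)
Lemma sign_eigen_lin_indep (V : lmodType C) (D : I -> {linear V -> V})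
    (X : {set I} -> V) :
  (forall S, X S != 0) -> (forall i S, D i (X S) = (-1) ^+ (i \in S) *: X S) ->
  lin_indep X.
Proof.
move=> X0 DX c cX S0.
pose q (l : seq I) (x : V) : V :=
  foldr (fun i y => y + (-1) ^+ (i \in S0) *: D i y) x l.
have q_sum l (d : {set I} -> C) (Y : {set I} -> V) :
    q l (\sum_S d S *: Y S) = \sum_S d S *: q l (Y S).
  elim: l => //= i l ->; rewrite linear_sum scaler_sumr -big_split /=.
  apply: eq_bigr => S _; rewrite linearZ /= scalerDr !scalerA.
  by rewrite [d S * _]mulrC.
have qZ l a x : q l (a *: x) = a *: q l x.
  elim: l => //= i l ->; rewrite linearZ /= scalerDr !scalerA.
  by rewrite [a * _]mulrC.
have qX l S : q l (X S) = (\prod_(i <- l) (1 + (-1) ^+ ((i \in S0) (+) (i \in S)))) *: X S.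
  elim: l => [|i l /= ->]; first by rewrite big_nil scale1r.
  rewrite big_cons linearZ /= DX mulrDl mul1r scalerDl !scalerA; congr (_ + _ *: _).
  by rewrite signr_addb mulrAC.
have := congr1 (q (enum I)) cX.
rewrite q_sum (bigD1 S0)//= big1 => [|S SS0]; last first.
  rewrite qX big_enum /=.
  (* An index at which S and S0 differ contributes the factor 1 - 1. *)
  have [i iS] : exists i, (i \in S0) != (i \in S).
    apply/existsP; apply: contraNT SS0; rewrite negb_exists => /forallP h.
    by apply/eqP/setP => i; have := h i; rewrite negbK => /eqP ->.
  have SiS0 : (i \in S0) (+) (i \in S) by move: iS; case: (i \in S0); case: (i \in S).
  rewrite (bigD1 i)//= SiS0 expr1 addrN mul0r.
  by rewrite scale0r scaler0.
have q0 : q (enum I) 0 = 0 by rewrite -[X in q _ X](scale0r (0 : V)) qZ scale0r.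
rewrite addr0 q0 qX big_enum /= => /eqP.
rewrite !scaler_eq0 (negbTE (X0 S0)) orbF => /orP[/eqP->//|/eqP].
under eq_bigr do rewrite addbb expr0.
rewrite prodr_const => /eqP; rewrite expf_eq0 => /andP[_].
by rewrite -[1 + 1]/(2%:R) pnatr_eq0.
Qed.

(* [x |-> t i ** g x ** t i] multiplies [monomial v t S] by [(-1)^(i \in S)]. *)
Lemma monomial_lin_indep (A : starAlgType C) (v : A) (t : I -> A)
    (g : {linear A -> A}) :
  spin_family v t -> v != 0 -> (forall i, v ** t i = t i) ->
  (forall i, t i ** v = t i) -> v ** v^** = v -> g v = v ->
  (forall i x, g (t i ** x) = - (t i ** g x)) ->
  lin_indep (monomial v t).
Proof.
move=> vt v0 vtl vtr vv gv gt.
pose d i x := (t i ** g x) ** t i.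
have dlin i : linear (d i).
  by move=> a x y; rewrite /d linearP smul_linearr smul_linearl.
pose D i : {linear A -> A} := HB.pack (d i) (GRing.isLinear.Build C A A *:%R _ (dlin i)).
apply: (@sign_eigen_lin_indep A D).
  by move=> S; apply: contra v0 => /eqP /(word_eq0 vt) ->.
move=> i S; rewrite /= /monomial.
(* Pulling out a letter [t j] costs one sign from [g] and, if j differs from i, a second one from
   anticommutation; only occurrences of i count. *)
have dword w : d i (word v t w) = (-1) ^+ count_mem i w *: word v t w.
  elim: w => [|j w IH] /=; first by rewrite /d gv vtr (sf_sqr vt) vv scale1r.
  rewrite /d gt smulNr smulA.
  have [ji|ij] := eqVneq j i; first subst j.
    rewrite exprD expr1 mulN1r scaleNr -smulZr -IH /d !smulA.
    by rewrite smulNl.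
  rewrite (sf_anti vt) ?(eq_sym i)// !smulNl opprK.
  by rewrite -smulZr -IH /d !smulA.
rewrite [LHS]dword; congr (_ ^+ _ *: _).
by rewrite count_uniq_mem ?sorted_word_uniq// sorted_wordE.
Qed.

End SpinFamilies.

(** * Finite-dimensional spans of operators are norm closed *)

Section ClosedSpans.
Variables (R : realType) (H : hilbertType R) (I : finType) (X : I -> bop H).
Local Notation C := R[i].

Definition bounded_map (f : bop H -> bop H) : Prop :=
  exists2 M : R, 0 <= M & forall x, rnorm (f x) <= M * rnorm x.

(* The projection onto a span grows by one dimension with the help of the
   functional [x |-> <x h, r h> / <r h, r h>], for an [h] with [r h != 0]. *)
Lemma bounded_projection (l : seq I) : exists g : bop H -> bop H,
  [/\ linear g, bounded_map g, forall i, i \in l -> g (X i) = X i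
    & forall x, fam_span X (g x)].
Proof.
elim: l => [|i l [g [glin [M M0 gM] gX gS]]].
  exists (fun=> 0); split=> //.
  - by move=> a x y; rewrite scaler0 addr0.
  - by exists 0 => // x; rewrite rnorm0 mul0r.
  - by move=> _; exact: fam_span0.
set r := X i - g (X i).
have [r0|/eqP r0] := eqVneq r 0.
  exists g; split=> //; first by exists M.
  move=> j; rewrite inE => /orP[/eqP->|/gX//].
  by apply/eqP; rewrite eq_sym -subr_eq0 -/r r0.
have [h rh] : exists h, r h != 0.
  apply: contrapT => /forallNP rh; apply: r0; apply: bopP => h.
  by apply: contrapT => /eqP; exact: rh.
have n0 : idot (r h) (r h) != 0 by rewrite idot_norm sqrf_eq0 normr_eq0.
pose lam (x : bop H) : C := idot (x h) (r h) / idot (r h) (r h).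
have lamlin a x y : lam (a *: x + y) = a * lam x + lam y.
  by rewrite /lam bopDE bopZE idotDl idotZl mulrDl mulrA.
have [N N0 lamN] : exists2 N : R, 0 <= N & forall x, rnorm (lam x) <= N * rnorm x.
  exists (rnorm h * rnorm (r h) * rnorm (idot (r h) (r h))^-1).
    by rewrite !mulr_ge0 ?rnorm_ge0.
  move=> x; rewrite /lam rnormM mulrAC ler_wpM2r ?rnorm_ge0//.
  apply: le_trans (rnorm_CS _ _) _; rewrite mulrAC ler_wpM2r ?rnorm_ge0//.
  by rewrite mulrC; exact: opnorm_bound.
(* [lam r] is 1, so [X i] goes to g (X i) + r, which is [X i]; members already fixed by [g] get no
   correction. *)
exists (fun x => g x + lam (x - g x) *: r); split.
- move=> a x y /=; rewrite glin.
  have -> : a *: x + y - (a *: g x + g y) = a *: (x - g x) + (y - g y).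
    by rewrite scalerBr opprD addrACA.
  by rewrite lamlin scalerDl [X in _ = X + _]scalerDr scalerA addrACA.
- exists (M + N * (1 + M) * rnorm r).
    by rewrite addr_ge0// !mulr_ge0 ?addr_ge0// rnorm_ge0.
  move=> x; apply: le_trans (rnormD _ _) _; rewrite mulrDl lerD// rnormZ.
  rewrite [leRHS]mulrAC ler_wpM2r ?rnorm_ge0//.
  apply: le_trans (lamN _) _; rewrite -mulrA ler_wpM2l//.
  apply: le_trans (rnormD _ _) _; rewrite rnormN mulrDl mul1r.
  by rewrite lerD2l.
- move=> j; rewrite inE => /orP[/eqP->|/gX gXj]; last first.
    by rewrite gXj subrr /lam bop0E idot0l mul0r scale0r addr0.
  by rewrite -/r /lam divff// scale1r addrC subrK.
- move=> x; rewrite addrC; apply: fam_spanZD => //.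
  rewrite /r addrC -scaleN1r; apply: fam_spanZD => //; exact: fam_span_mem.
Qed.

(** A bounded linear map [g] with values in the span fixes the span. If y in the span is within e of
    x, then x - g x equals (x - y) - g (x - y), of norm at most e (1 + M), so points of the closure
    are fixed too. *)
Lemma fam_span_closed : closed (fam_span X).
Proof.
have [g [glin [M M0 gM] gX gS]] := bounded_projection (enum I).
have gB x y : g (x - y) = g x - g y.
  by rewrite -[x - y]addrC -scaleN1r glin scaleN1r addrC.
have gfix : fam_span X `<=` [set x | g x = x].
  apply: subspace_fam_span => [|i]; last by apply: gX; rewrite mem_enum.
  split=> [|a x y /= gx gy]; last by rewrite glin gx gy.
  by have := gB 0 0; rewrite /= !subrr.
move=> x xcl; suff -> : x = g x by [].
apply/eqP; rewrite -subr_eq0; apply/eqP/rnorm0_eq0/le_anti.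
rewrite rnorm_ge0 andbT; apply: (@small_le0 _ _ (1 + M)); first by rewrite addr_ge0.
move=> e e0; have [|y [yS]] := xcl (ball x e%:C).
  by apply: nbhsx_ballx; rewrite ltcR.
rewrite -ball_normE /= rnormE ltcR => xy.
have -> : x - g x = (x - y) - g (x - y).
  by rewrite gB (gfix _ yS) opprB addrA subrK.
apply: le_trans (rnormD _ _) _; rewrite rnormN.
have h2 := gM (x - y).
rewrite mulrDr mulr1; apply: lerD; first exact: ltW.
apply: le_trans h2 _; rewrite mulrC ler_wpM2r ?rnorm_ge0//; exact: ltW.
Qed.

End ClosedSpans.

(* A copy of the product, whose own norm is the maximum norm, to carry the
   l^2 norm. *)
Definition hsum (R : realType) (H : hilbertType R) : Type := (H * H)%type.

(** * The Hilbert space sum of two copies of [H] *)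

Section HilbertSum.
Variables (R : realType) (H : hilbertType R).
Local Notation C := R[i].

HB.instance Definition _ := GRing.Lmodule.copy (hsum H) (H * H)%type.

Implicit Types x y z : hsum H.

Definition hsum_idot x y : C := idot x.1 y.1 + idot x.2 y.2.

Lemma hsum_idot_bilinear :
  bilinear_for (GRing.Scale.Law.clone C _ *%R _)
    (GRing.Scale.Law.clone C _ (Num.conj \; *%R) _) hsum_idot.
Proof.
split=> [z a x y|z a x y]; rewrite /hsum_idot /=.
  by rewrite !idotDl !idotZl mulrDr addrACA.
by rewrite !idotDr !idotZr mulrDr addrACA.
Qed.

HB.instance Definition _ := bilinear_isBilinear.Build C (hsum H) (hsum H) C
  _ _ hsum_idot hsum_idot_bilinear.

Lemma hsum_idotC x y : hsum_idot x y = (-1) ^+ false * Num.conj (hsum_idot y x).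
Proof. by rewrite expr0 mul1r /hsum_idot rmorphD /= -!idotC. Qed.

HB.instance Definition _ := isHermitianSesquilinear.Build C (hsum H) false
  Num.conj hsum_idot hsum_idotC.

Definition hsum_rnorm x : R := Num.sqrt (rnorm x.1 ^+ 2 + rnorm x.2 ^+ 2).

Lemma hsum_rnorm_sqr x : hsum_rnorm x ^+ 2 = rnorm x.1 ^+ 2 + rnorm x.2 ^+ 2.
Proof. by rewrite sqr_sqrtr// addr_ge0// exprn_ge0// rnorm_ge0. Qed.

Lemma hsum_rnorm_ge0 x : 0 <= hsum_rnorm x.
Proof. exact: sqrtr_ge0. Qed.

Lemma hsum_rnorm_le x M : 0 <= M ->
  rnorm x.1 ^+ 2 + rnorm x.2 ^+ 2 <= M ^+ 2 -> hsum_rnorm x <= M.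
Proof.
by move=> M0; rewrite -hsum_rnorm_sqr ler_pXn2r// nnegrE ?hsum_rnorm_ge0.
Qed.

Lemma rnorm_fst_le x : rnorm x.1 <= hsum_rnorm x.
Proof.
rewrite -(@ler_pXn2r _ 2) ?nnegrE ?hsum_rnorm_ge0 ?rnorm_ge0//.
by rewrite hsum_rnorm_sqr lerDl exprn_ge0 ?rnorm_ge0.
Qed.

Lemma rnorm_snd_le x : rnorm x.2 <= hsum_rnorm x.
Proof.
rewrite -(@ler_pXn2r _ 2) ?nnegrE ?hsum_rnorm_ge0 ?rnorm_ge0//.
by rewrite hsum_rnorm_sqr lerDr exprn_ge0 ?rnorm_ge0.
Qed.

Lemma hsum_rnorm_le_add x : hsum_rnorm x <= rnorm x.1 + rnorm x.2.
Proof.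
apply: hsum_rnorm_le; first by rewrite addr_ge0 ?rnorm_ge0.
by have := rnorm_ge0 x.1; have := rnorm_ge0 x.2; nra.
Qed.

Lemma hsum_rnormD x y : hsum_rnorm (x + y) <= hsum_rnorm x + hsum_rnorm y.
Proof.
apply: hsum_rnorm_le; first by rewrite addr_ge0 ?hsum_rnorm_ge0.
have /= h1 := rnormD x.1 y.1; have /= h2 := rnormD x.2 y.2.
have p1 := rnorm_ge0 x.1; have p2 := rnorm_ge0 x.2.
have q1 := rnorm_ge0 y.1; have q2 := rnorm_ge0 y.2.
have CS : rnorm x.1 * rnorm y.1 + rnorm x.2 * rnorm y.2 <=
    hsum_rnorm x * hsum_rnorm y.
  rewrite -(@ler_pXn2r _ 2) ?nnegrE ?mulr_ge0 ?addr_ge0 ?mulr_ge0 ?hsum_rnorm_ge0//.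
  rewrite exprMn !hsum_rnorm_sqr.
  (* Lagrange's identity: this square is the difference of the two sides. *)
  have := sqr_ge0 (rnorm x.1 * rnorm y.2 - rnorm x.2 * rnorm y.1).
  by nra.
have e1 := hsum_rnorm_sqr x; have e2 := hsum_rnorm_sqr y.
have m1 : rnorm (x + y).1 ^+ 2 <= (rnorm x.1 + rnorm y.1) ^+ 2.
  by rewrite ler_pXn2r ?nnegrE ?addr_ge0 ?rnorm_ge0.
have m2 : rnorm (x + y).2 ^+ 2 <= (rnorm x.2 + rnorm y.2) ^+ 2.
  by rewrite ler_pXn2r ?nnegrE ?addr_ge0 ?rnorm_ge0.
apply: le_trans (lerD m1 m2) _.
rewrite !sqrrD e1 e2; lra.
Qed.

Definition hsum_norm x : C := (hsum_rnorm x)%:C.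

Lemma hsum_normD x y : hsum_norm (x + y) <= hsum_norm x + hsum_norm y.
Proof. by rewrite -rmorphD lecR hsum_rnormD. Qed.

Lemma hsum_normZ (a : C) x : hsum_norm (a *: x) = `|a| * hsum_norm x.
Proof.
rewrite rnormE -rmorphM; congr _%:C.
apply: (@pexpIrn _ 2) => //; rewrite ?nnegrE ?mulr_ge0 ?hsum_rnorm_ge0 ?rnorm_ge0//.
by rewrite exprMn !hsum_rnorm_sqr !rnormZ !exprMn mulrDr.
Qed.

Lemma hsum_norm0_eq0 x : hsum_norm x = 0 -> x = 0.
Proof.
move=> /(@complexI R) x0.
have [x1 x2] := (rnorm_fst_le x, rnorm_snd_le x); rewrite x0 in x1 x2.
rewrite [x]surjective_pairing; congr pair; apply: rnorm0_eq0; apply/le_anti.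
  by rewrite x1 rnorm_ge0.
by rewrite x2 rnorm_ge0.
Qed.

HB.instance Definition _ :=
  Lmodule_isNormed.Build C (hsum H) hsum_normD hsum_normZ hsum_norm0_eq0.

Lemma hsum_rnormE x : rnorm x = hsum_rnorm x.
Proof. by []. Qed.

Lemma hsum_idot_norm x : hsum_idot x x = `|x| ^+ 2.
Proof.
rewrite rnormE -real_complexX2 hsum_rnormE hsum_rnorm_sqr rmorphD /=.
by rewrite /hsum_idot !rnorm_idot.
Qed.

Lemma hsum_idot_gt0 x : x != 0 -> 0 < hsum_idot x x.
Proof. by move=> x0; rewrite hsum_idot_norm exprn_gt0// normr_gt0. Qed.

HB.instance Definition _ := isDotProduct.Build C (hsum H) hsum_idot hsum_idot_gt0.

(** Coordinates do not increase the norm, so both converge along [F]; the pair of limits is the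
    limit, as the norm is at most the sum of the coordinate norms. *)
Lemma hsum_complete (F : set_system (hsum H)) :
  ProperFilter F -> cauchy F -> cvg F.
Proof.
move=> FF /cauchyP Fc.
have Fc' (e : R) : 0 < e -> exists x, F [set y | rnorm (x - y) < e].
  move=> e0; have e0' : 0 < e%:C by rewrite ltcR.
  have [x Fx] := Fc _ e0'.
  by exists x; apply: filterS Fx => y; rewrite -ball_normE /= rnormE ltcR.
have cvg_coord (pr : hsum H -> H) :
    (forall x y, rnorm (pr x - pr y) <= rnorm (x - y)) -> cvg (pr @ F).
  move=> prle; apply: (@cauchy_cvg H); apply/cauchy_exP => _ /gt0_complexE[e e0 ->].
  have [x Fx] := Fc' _ e0; exists (pr x); rewrite /= /nbhs /=.
  apply: filterS Fx => y /= xy; rewrite -ball_normE /= rnormE ltcR.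
  exact: le_lt_trans (prle x y) xy.
have near_lim (pr : hsum H -> H) : cvg (pr @ F) -> forall e : R, 0 < e ->
    F [set x | rnorm (lim (pr @ F) - pr x) < e].
  move=> prF e e0; have := prF (ball (lim (pr @ F)) e%:C).
  move=> /(_ (nbhsx_ballx _ _ _)); rewrite ltcR => /(_ e0).
  rewrite /= /nbhs /=; apply: filterS => x /=.
  by rewrite -ball_normE /= rnormE ltcR.
have F1 := near_lim fst (cvg_coord _ (fun x y => rnorm_fst_le (x - y))).
have F2 := near_lim snd (cvg_coord _ (fun x y => rnorm_snd_le (x - y))).
apply/(@cvg_ex (hsum H)).
exists ((lim (@fst H H @ F), lim (@snd H H @ F)) : hsum H).
apply/cvgrPdist_lt => _ /gt0_complexE[e e0 ->].
have e2 : 0 < e / 2 by rewrite divr_gt0.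
rewrite near_simpl; apply: filterS2 (F1 _ e2) (F2 _ e2) => x /= h1 h2.
rewrite rnormE ltcR; apply: le_lt_trans (hsum_rnorm_le_add _) _ => /=.
lra.
Qed.

HB.instance Definition _ := Uniform_isComplete.Build (hsum H) hsum_complete.

HB.instance Definition _ := isHilbert.Build R (hsum H) hsum_idot_norm.

End HilbertSum.

(** * Diagonal operators and the flip on the sum *)

Section HilbertSumOperators.
Variables (R : realType) (H : hilbertType R).
Local Notation C := R[i].
Implicit Types (f g : bop H) (x y : hsum H).

Lemma bdiag_subproof f g :
  `[< @is_bounded_op R (hsum H) (fun x => (f x.1, g x.2)) >].
Proof.
apply/asboolP.
have lin : linear ((fun x => (f x.1, g x.2)) : hsum H -> hsum H).
  by move=> a x y; rewrite /= !bop_linear.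
split=> //; apply/(bounded_opP lin).
exists (opnorm f + opnorm g); first by rewrite addr_ge0 ?opnorm_ge0.
move=> x; apply: le_trans (hsum_rnorm_le_add _) _; rewrite mulrDl /=.
by apply: lerD; apply: le_trans (opnorm_bound _ _) _;
  rewrite ler_wpM2l ?opnorm_ge0 ?rnorm_fst_le ?rnorm_snd_le.
Qed.

Definition bdiag f g : bop (hsum H) := Bop (bdiag_subproof f g).

Lemma bdiagM f g f' g' : bdiag f g ** bdiag f' g' = bdiag (f ** f') (g ** g').
Proof. by apply: bopP. Qed.

Lemma bdiagD f g f' g' : bdiag f g + bdiag f' g' = bdiag (f + f') (g + g').
Proof. by apply: bopP. Qed.

Lemma bdiagN f g : - bdiag f g = bdiag (- f) (- g).
Proof. by apply: bopP. Qed.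

Lemma bdiagZ (a : C) f g : a *: bdiag f g = bdiag (a *: f) (a *: g).
Proof. by apply: bopP. Qed.

Lemma bdiag_star f g : (bdiag f g)^** = bdiag f^** g^**.
Proof.
apply: bopP => y; apply: idot_inj => x; rewrite -adjointP.
by rewrite -[LHS]/(hsum_idot _ _) /hsum_idot /= !adjointP.
Qed.

Lemma bdiag_id : bdiag (bop_id H) (bop_id H) = bop_id (hsum H).
Proof. by apply: bopP => -[]. Qed.

Lemma bswap_subproof : `[< @is_bounded_op R (hsum H) (fun x => (x.2, x.1)) >].
Proof.
apply/asboolP; have lin : linear ((fun x => (x.2, x.1)) : hsum H -> hsum H) by [].
split=> //; apply/(bounded_opP lin); exists 1 => // x.
by rewrite mul1r !hsum_rnormE /hsum_rnorm /= addrC.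
Qed.

Definition bswap : bop (hsum H) := Bop bswap_subproof.

Lemma bswap_diag f g : bswap ** bdiag f g = bdiag g f ** bswap.
Proof. by apply: bopP. Qed.

Lemma bswapK : bswap ** bswap = bop_id (hsum H).
Proof. by apply: bopP => -[]. Qed.

Lemma smul1l f : bop_id H ** f = f.
Proof. by apply: bopP. Qed.

Lemma smul1r f : f ** bop_id H = f.
Proof. by apply: bopP. Qed.

Lemma star_bop_id : (bop_id H)^** = bop_id H.
Proof. by apply: bopP => y; apply: idot_inj => x; rewrite -adjointP. Qed.

End HilbertSumOperators.

(** * A spin system with independent monomials *)

Section SpinModel.
Variables (R : realType) (H : hilbertType R) (k : nat) (s : 'I_k -> bop H).
Hypothesis ss : is_spin_system s.
Local Notation C := R[i].

Lemma spin_sqr i : s i ** s i = bop_id H.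
Proof.
have [_ _ /(_ i i)] := ss; rewrite eqxx mulr1 -mulr2n -scaler_nat.
have n2 : (2 : C) != 0 by rewrite pnatr_eq0.
by move=> /(congr1 ( *:%R 2^-1)); rewrite !scalerA mulVf// !scale1r.
Qed.

Lemma spin_anti i j : i != j -> s i ** s j = - (s j ** s i).
Proof.
have [_ _ /(_ i j)] := ss => + /negbTE ij; rewrite ij mulr0 scale0r.
by move=> /eqP; rewrite addr_eq0 => /eqP.
Qed.

(** The opposite sign makes the flip anticommute with every generator, even when the monomials in
    [s] are dependent, as for the three Pauli matrices. *)
Definition model i : bop (hsum H) := bdiag (s i) (- s i).

Lemma model_spin_family : spin_family (bop_id (hsum H)) model.
Proof.
split=> [|i|i|i|i j ij].
- by rewrite /tprod star_bop_id !smul1l.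
- by rewrite /model bdiag_star starN; have [_ -> _] := ss.
- by rewrite star_bop_id !smul1l.
- rewrite star_bop_id smul1l /model bdiagM smulNl smulNr opprK spin_sqr.
  exact: bdiag_id.
- by rewrite /model !bdiagM !smulNl !smulNr !opprK spin_anti// bdiagN.
Qed.

(** The grading is conjugation by the flip: it fixes the identity and changes the sign of each
    generator. On the zero space all monomials would vanish, whence the hypothesis. *)
Lemma model_lin_indep : bop_id H != 0 -> lin_indep (monomial (bop_id (hsum H)) model).
Proof.
move=> id0.
pose g (x : bop (hsum H)) := (bswap H ** x) ** bswap H.
have glin : linear g.
  by move=> a x y; rewrite /g smul_linearr smul_linearl.
pose G : {linear bop (hsum H) -> bop (hsum H)} :=
  HB.pack g (GRing.isLinear.Build C _ _ *:%R g glin).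
apply: (@monomial_lin_indep _ _ _ _ _ G) => /=.
- exact: model_spin_family.
- apply: contra id0 => /eqP id0; apply/eqP/bopP => x.
  by have := congr1 (fun f : bop (hsum H) => (f (x, x)).1) id0.
- by move=> i; rewrite smul1l.
- by move=> i; rewrite smul1r.
- by rewrite star_bop_id smul1l.
- by rewrite /g smul1r bswapK.
- move=> i x; rewrite /g /model !smulA bswap_diag -!smulNl; congr (_ ** _ ** _).
  by rewrite bdiagN opprK.
Qed.

End SpinModel.

(** * Comparison of the sizes of independent and spanning families *)

Section Dimension.
Variable C : numClosedFieldType.

(** With more rows than columns the coefficient matrix has a non-zero left kernel, and each row of
    that kernel is a linear relation between the [X i]. *)
Lemma lin_indep_size (V : lmodType C) m n (X : 'I_m -> V) (Y : 'I_n -> V) :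
  lin_indep X -> (forall i, fam_span Y (X i)) -> (m <= n)%N.
Proof.
move=> Xfree XY; pose c i : 'I_n -> C := projT1 (cid (XY i)).
have cE i : X i = \sum_j c i j *: Y j by rewrite /c; case: cid.
pose M := \matrix_(i < m, j < n) c i j.
rewrite leqNgt; apply/negP => nm.
have : kermx M != 0.
  by rewrite -mxrank_eq0 mxrank_ker subn_eq0 -ltnNge (leq_ltn_trans (rank_leq_col M)).
move=> /eqP; apply; apply/row_matrixP => r; rewrite row0; set u := row r _.
have uM : u *m M = 0 by apply/sub_kermxP; exact: row_sub.
apply/rowP => i; rewrite [RHS]mxE; apply: (Xfree (fun i => u 0 i)).
under eq_bigr do rewrite cE scaler_sumr.
rewrite exchange_big big1//= => j _.
have := congr1 (fun N : 'rV_n => N 0 j) uM; rewrite /M !mxE => uMj.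
rewrite -[RHS](scale0r (Y j)) -[in RHS]uMj scaler_suml.
apply: eq_bigr => l _; rewrite scalerA; congr (_ * _ *: _); by rewrite mxE.
Qed.

Lemma lin_indep_image (V W : lmodType C) (I : finType) (S : set V) (f : V -> W)
    (X : I -> V) :
  is_subspace S -> linear_on S f -> set_inj S f -> (forall i, S (X i)) ->
  lin_indep X -> lin_indep (f \o X).
Proof.
move=> Ssub fl finj SX Xfree c cX; apply: Xfree.
have S0 : S 0 := Ssub.1.
have f0 : f 0 = 0 by have := fl (-1) 0 0 S0 S0; rewrite !scaleN1r !addNr.
apply: finj; rewrite ?inE//; first exact: subspace_sum.
by rewrite (linear_on_sum _ _ Ssub)// f0 -[RHS]cX.
Qed.

End Dimension.

(** * Composition and inversion of triple homomorphisms *)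

Section JordanTriples.
Variable C : numClosedFieldType.
Implicit Types A B D : starAlgType C.

Lemma jb_hom_comp A B D (S : set A) (T : set B) (U : set D) f g :
  jb_hom S T f -> jb_hom T U g -> jb_hom S U (g \o f).
Proof.
move=> [fT fl fj] [gU gl gj]; split=> [x /fT /gU //|a x y Sx Sy|x y z Sx Sy Sz] /=.
  by rewrite fl// gl//; exact: fT.
by rewrite fj// gj//; exact: fT.
Qed.

Lemma jb_hom_inverse A B (S : set A) (T : set B) f :
  is_subspace S -> (forall a b c, S a -> S b -> S c -> S (jprod a b c)) ->
  jb_hom S T f -> set_bij S T f ->
  exists g, [/\ jb_hom T S g, forall x, S x -> g (f x) = x
    & forall y, T y -> f (g y) = y].
Proof.
move=> [S0 SZD] Sj [fT fl fj] [_ finj fsurj].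
pose g y := xget 0 [set x | S x /\ f x = y].
have gP y : T y -> S (g y) /\ f (g y) = y.
  move=> /fsurj [x Sx xy]; rewrite /g; case: xgetP => [z _ //|].
  by move=> /(_ x) [].
have ginv x : S x -> g (f x) = x.
  move=> Sx; have [Sg fg] := gP _ (fT _ Sx).
  by apply: finj fg; rewrite inE.
exists g; split=> // [|y /gP[]//]; split=> [y /gP[]//|a x y Tx Ty|x y z Tx Ty Tz].
  have [[Sx {1}<-] [Sy {1}<-]] := (gP _ Tx, gP _ Ty).
  by rewrite -fl// ginv//; exact: SZD.
have [[Sx {1}<-] [Sy {1}<-] [Sz {1}<-]] := And3 (gP _ Tx) (gP _ Ty) (gP _ Tz).
by rewrite -fj// ginv//; exact: Sj.
Qed.

End JordanTriples.

(** * The triple product of a spin system and its homomorphisms *)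

Section SpinSystems.
Variables (R : realType) (H : hilbertType R) (k : nat) (s : 'I_k -> bop H).
Hypothesis ss : is_spin_system s.
Local Notation C := R[i].

Definition spin_basis (i : 'I_k.+1) : bop H :=
  oapp s (bop_id H) (unlift ord0 i).

Definition spin_vec (a : C) (c : 'I_k -> C) : bop H :=
  a *: bop_id H + \sum_i c i *: s i.

Lemma spin_basis_sum (c : 'I_k.+1 -> C) :
  \sum_i c i *: spin_basis i = spin_vec (c ord0) (fun i => c (lift ord0 i)).
Proof.
rewrite big_ord_recl /spin_basis unlift_none; congr (_ + _).
by apply: eq_bigr => i _; rewrite liftK.
Qed.

Lemma spin_spanE : spin_span s = fam_span spin_basis.
Proof.
apply/seteqP; split=> x; last first.
  by move=> [c ->]; rewrite spin_basis_sum; exists (c ord0), (fun i => c (lift ord0 i)).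
move=> [a [c ->]]; exists (fun i => oapp c a (unlift ord0 i)).
rewrite spin_basis_sum unlift_none; congr (_ + _).
by apply: eq_bigr => i _; rewrite liftK.
Qed.

Lemma spin_span_id : spin_span s (bop_id H).
Proof.
have := fam_span_mem spin_basis ord0; rewrite -spin_spanE.
by rewrite /spin_basis unlift_none.
Qed.

Lemma spin_span_gen i : spin_span s (s i).
Proof.
have := fam_span_mem spin_basis (lift ord0 i); rewrite -spin_spanE.
by rewrite /spin_basis liftK.
Qed.

(** Exchanging the sums in the second product pairs [s i ** s j] with [s j ** s i] under one
    coefficient, so only the diagonal survives. *)
Lemma spin_comb_anticomm (c d : 'I_k -> C) :
  (\sum_i c i *: s i) ** (\sum_i d i *: s i) +
  (\sum_i d i *: s i) ** (\sum_i c i *: s i) =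
  (2 * \sum_i c i * d i) *: bop_id H.
Proof.
have [_ _ sij] := ss.
rewrite !smul_suml.
under eq_bigr do rewrite smul_sumr scaler_sumr.
under [X in _ + X]eq_bigr do rewrite smul_sumr scaler_sumr.
rewrite [X in _ + X]exchange_big -big_split mulr_sumr scaler_suml /=.
apply: eq_bigr => i _; rewrite -big_split /= (bigD1 i)//= big1 => [|j ji].
  by rewrite addr0 !scalerA [d i * _]mulrC -scalerDr sij eqxx mulr1 scalerA mulrC.
by rewrite !scalerA [d j * _]mulrC -scalerDr sij eq_sym (negbTE ji) mulr0 scale0r scaler0.
Qed.

Lemma spin_vecN (c : 'I_k -> C) :
  \sum_i (- c i) *: s i = - \sum_i c i *: s i.
Proof. by rewrite -sumrN; apply: eq_bigr => i _; rewrite scaleNr. Qed.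

(** Write bar for the sign change of the spin part. In x y + bar y bar x the mixed terms cancel and
    the spin parts anticommute to a scalar; this is the tool for reordering products. *)
Lemma spin_vec_conj_mul (a b : C) (c d : 'I_k -> C) :
  spin_vec a c ** spin_vec b d +
    spin_vec b (fun i => - d i) ** spin_vec a (fun i => - c i) =
  (2 * (a * b + \sum_i c i * d i)) *: bop_id H.
Proof.
rewrite mulrDr scalerDl -spin_comb_anticomm /spin_vec !spin_vecN.
set x := \sum_i c i *: s i; set y := \sum_i d i *: s i.
rewrite !smulDl !smulDr !smulZl !smulZr !smul1l !smul1r !smulNl !smulNr opprK.
rewrite !scalerN !scalerA [b * a]mulrC mulr2n mulrDl mul1r scalerDl.
set p := (a * b) *: _.
have -> : p + a *: y + (b *: x + x ** y) + (p - b *: x + (- (a *: y) + y ** x)) =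
  (p + p) + (x ** y + y ** x) + ((a *: y - a *: y) + (b *: x - b *: x)).
  by rewrite (AC ((2*2)*(2*2)) ((1*5)*(4*8)*((2*7)*(3*6)))).
by rewrite !subrr !addr0.
Qed.

(** The triple product depends on the coordinates only, so it has the same form for every spin
    system of length [k]. Reordering x y* and z y* leaves -w (bar x z + bar z x) besides scalar
    multiples of z and x, and the bracket is again scalar. *)
Lemma spin_vec_jprod (a b e : C) (c d f : 'I_k -> C) :
  let b' := Num.conj b in let d' i := Num.conj (d i) in
  jprod (spin_vec a c) (spin_vec b d) (spin_vec e f) =
  (a * b' + \sum_i c i * d' i) *: spin_vec e f
  + (e * b' + \sum_i f i * d' i) *: spin_vec a c
  - (a * e - \sum_i c i * f i) *: spin_vec b' (fun i => - d' i).
Proof.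
move=> b' d'; have [_ sstar _] := ss.
have vstar : (spin_vec b d)^** = spin_vec b' d'.
  rewrite /spin_vec starD starZ star_bop_id star_sum; congr (_ + _).
  by apply: eq_bigr => i _; rewrite sstar.
rewrite /jprod /tprod vstar.
have flip a1 c1 : spin_vec a1 c1 ** spin_vec b' d' =
    (2 * (a1 * b' + \sum_i c1 i * d' i)) *: bop_id H -
    spin_vec b' (fun i => - d' i) ** spin_vec a1 (fun i => - c1 i).
  by rewrite -spin_vec_conj_mul addrK.
rewrite !flip; set w := spin_vec b' _.
rewrite [(_ - _) ** spin_vec e f]smulDl [(_ - _) ** spin_vec a c]smulDl.
rewrite !(smulZl _ (bop_id H)) !smul1l !smulNl.
have e1 : spin_vec a (fun i => - c i) ** spin_vec e f +
    spin_vec e (fun i => - f i) ** spin_vec a c =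
    (2 * (a * e - \sum_i c i * f i)) *: bop_id H.
  have := spin_vec_conj_mul a e (fun i => - c i) f.
  have -> : (fun i => - - c i) = c by apply/funext => i; rewrite opprK.
  move=> ->; congr ((_ * (_ + _)) *: _).
  by rewrite -sumrN; apply: eq_bigr => i _; rewrite mulNr.
rewrite addrACA -opprD -!smulA -smulDr e1 smulZr smul1r.
have n2 : (2 : C) != 0 by rewrite pnatr_eq0.
by rewrite scalerBr (scalerDr 2^-1) !scalerA !mulrA mulVf// !mul1r.
Qed.

(** Anticommuting a relation a + sum d_j s_j = 0 with s_i gives a s_i = - d_i. If a were non-zero,
    all s_i would be scalars with d_i d_j = 0 for distinct i, j and d_i^2 = a^2, impossible for two
    indices. *)
Lemma spin_basis_lin_indep : bop_id H != 0 -> lin_indep spin_basis.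
Proof.
move=> id0 c; rewrite spin_basis_sum => c0.
have [k2 _ sij] := ss.
have n2 : (2 : C) != 0 by rewrite pnatr_eq0.
set a := c ord0 in c0; set d := (fun i => c (lift ord0 i)) in c0.
have ad i : a *: s i + d i *: bop_id H = 0.
  have e : (\sum_j (j == i)%:R *: s j) = s i.
    rewrite (bigD1 i)//= eqxx scale1r big1 ?addr0// => j /negbTE ->.
    by rewrite scale0r.
  have h : \sum_j d j * (j == i)%:R = d i.
    rewrite (bigD1 i)//= eqxx mulr1 big1 ?addr0// => j /negbTE ->.
    by rewrite mulr0.
  have := spin_comb_anticomm d (fun j => (j == i)%:R); rewrite e h.
  have -> : \sum_j d j *: s j = - (a *: bop_id H).
    by apply/eqP; rewrite -addr_eq0 addrC; apply/eqP.
  rewrite smulNl smulNr smulZl smulZr smul1l smul1r -mulr2n -scaler_nat.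
  rewrite -scalerA scalerN => /(congr1 ( *:%R 2^-1)).
  rewrite scalerN !scalerA !mulrA mulVf// !mul1r => <-.
  by rewrite subrr.
have a0 : a = 0.
  apply/eqP; apply: contraT => a0.
  have sE i : s i = (- d i / a) *: bop_id H.
    apply: (@scalerI _ _ a) => //; rewrite scalerA mulrC divfK// scaleNr.
    by apply/eqP; rewrite -addr_eq0 ad.
  have ddE i j : 2 * (d i * d j) = 2 * (i == j)%:R * a ^+ 2.
    have := sij i j; rewrite [s i]sE [s j]sE !smulZl !smulZr !smul1l !scalerA.
    rewrite -scalerDl => /eqP; rewrite -subr_eq0 -scalerBl scaler_eq0 (negbTE id0) orbF.
    by rewrite subr_eq0 => /eqP <-; field.
  have := ddE (Ordinal (ltnW k2)) (Ordinal k2); rewrite mulr0 mul0r => /eqP.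
  rewrite !mulf_eq0 (negbTE n2) /= => /orP[] /eqP di0.
    have := ddE (Ordinal (ltnW k2)) (Ordinal (ltnW k2)); rewrite di0 eqxx mul0r mulr0 mulr1.
    by move=> /esym/eqP; rewrite mulf_eq0 (negbTE n2) expf_eq0 (negbTE a0).
  have := ddE (Ordinal k2) (Ordinal k2); rewrite di0 eqxx mul0r mulr0 mulr1.
  by move=> /esym/eqP; rewrite mulf_eq0 (negbTE n2) expf_eq0 (negbTE a0).
move=> i; have [j ->|->//] := unliftP ord0 i.
have := ad j; rewrite a0 scale0r add0r => /eqP.
by rewrite scaler_eq0 (negbTE id0) orbF => /eqP.
Qed.

Section JBHom.
Variables (B : starAlgType C) (T : set B) (beta : bop H -> B).
Hypothesis betaP : jb_hom (spin_span s) T beta.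
Let v := beta (bop_id H).
Let a i := beta (s i).

(** Put p = v v* and q = v* v. The image of {1,1,s} = s reads p a + a q = 2 a; multiplying by p on
    the left and by q on the right gives p a = p a q = a q, hence both equal a. The last identity is
    the image of {1,s,1} = s. *)
Lemma jb_hom_spin_tprod : tprod v v v = v /\ forall i,
  [/\ (v ** v^**) ** a i = a i, (a i ** v^**) ** v = a i
    & (v ** (a i)^**) ** v = a i].
Proof.
have [_ _ bj] := betaP; have [_ sstar _] := ss.
have S1 := spin_span_id; have Ss := spin_span_gen.
have n2 : (2 : C) != 0 by rewrite pnatr_eq0.
have half (x : bop H) : 2^-1 *: (x + x) = x.
  by rewrite -mulr2n -[x *+ 2]scaler_nat scalerA mulVf// scale1r.
have halfB (x : B) : 2^-1 *: (x + x) = x.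
  by rewrite -mulr2n -[x *+ 2]scaler_nat scalerA mulVf// scale1r.
have vvv : tprod v v v = v.
  rewrite -[LHS]halfB -[LHS]/(jprod v v v) -bj// /jprod /tprod star_bop_id.
  by rewrite !smul1l half.
split=> // i.
have h1 : (v ** v^**) ** a i + (a i ** v^**) ** v = 2 *: a i.
  have := bj _ _ _ S1 S1 (Ss i); rewrite {1}/jprod /tprod star_bop_id.
  rewrite !smul1l !smul1r half -/(a i) => {3}->.
  by rewrite /jprod scalerA mulfV// scale1r.
have h2 : (v ** (a i)^**) ** v = a i.
  have := bj _ _ _ S1 (Ss i) S1; rewrite {1}/jprod /tprod sstar.
  by rewrite smul1l smul1r half -/(a i) {1}/jprod halfB /tprod => <-.
have pp x : (v ** v^**) ** ((v ** v^**) ** x) = (v ** v^**) ** x.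
  by rewrite smulA; congr (_ ** _); rewrite smulA -[X in X ** _]/(tprod v v v) vvv.
have pa : (v ** v^**) ** a i = (v ** v^**) ** ((a i ** v^**) ** v).
  have := congr1 (smul (v ** v^**)) h1; rewrite smulDr pp smulZr.
  rewrite scaler_nat mulr2n; by move=> /addrI.
have qa : (a i ** v^**) ** v = (v ** v^**) ** ((a i ** v^**) ** v).
  have := congr1 (fun x => (x ** v^**) ** v) h1.
  rewrite !smulDl !smulZl; set y := (a i ** v^**) ** v.
  have -> : (y ** v^**) ** v = y.
    rewrite /y -[RHS]smulA; have := congr1 (fun x => (a i ** v^**) ** x) vvv.
    by rewrite /tprod !smulA.
  have -> : ((((v ** v^**) ** a i) ** v^**) ** v) = (v ** v^**) ** y.
    by rewrite /y !smulA.
  rewrite scaler_nat mulr2n; move=> /addIr; exact: esym.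
have pq : (v ** v^**) ** a i = (a i ** v^**) ** v by rewrite pa -qa.
have pai : (v ** v^**) ** a i = a i.
  by rewrite -[RHS](halfB) -[a i + a i]mulr2n -[a i *+ 2]scaler_nat -h1 -pq halfB.
by split=> //; rewrite -pq.
Qed.

Lemma jb_hom_spin_gen i : (a i ** v^**) ** v = a i.
Proof. by have [_ /(_ i) []] := jb_hom_spin_tprod. Qed.

(** The relations between the symmetries are the image of {s_i,1,s_j} = delta_ij 1, multiplied by v*
    on the right. Self-adjointness follows from v a_i* v = a_i, after a_i* is replaced by a_i* v
    v*. *)
Lemma jb_hom_spin_family : spin_family v (fun i => a i ** v^**).
Proof.
have [vvv av] := jb_hom_spin_tprod.
have [_ bl bj] := betaP; have [_ _ sij] := ss.
have S1 := spin_span_id; have Ss := spin_span_gen.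
have n2 : (2 : C) != 0 by rewrite pnatr_eq0.
have S0 : spin_span s 0 by rewrite spin_spanE; exact: fam_span0.
have b0 : beta 0 = 0 by have := bl (-1) 0 0 S0 S0; rewrite !scaleN1r !addNr.
have bZ c : beta (c *: bop_id H) = c *: v by have := bl c _ _ S1 S0; rewrite b0 !addr0.
have anti i j : (a i ** v^**) ** (a j ** v^**) + (a j ** v^**) ** (a i ** v^**) =
    (2 * (i == j)%:R) *: (v ** v^**).
  have := bj _ _ _ (Ss i) S1 (Ss j); rewrite {1}/jprod /tprod star_bop_id.
  rewrite !smul1r sij scalerA mulrA mulVf// mul1r bZ => /(congr1 ( *:%R 2)).
  rewrite /jprod !scalerA mulfV// scale1r => /(congr1 (fun x => x ** v^**)).
  by rewrite smulZl smulDl /tprod !smulA => ->.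
split=> // [i|i|i|i j ij].
- have [pa _ vav] := av i; rewrite starM starK.
  have -> : (a i)^** = (a i)^** ** (v ** v^**).
    by rewrite -{1}pa !starM !starK.
  by rewrite !smulA vav.
- by have [pa _ _] := av i; rewrite smulA pa.
- have := anti i i; rewrite eqxx mulr1 -mulr2n -scaler_nat.
  by move=> /(scalerI n2).
- have := anti i j; rewrite (negbTE ij) mulr0 scale0r => /eqP.
  by rewrite addr_eq0 => /eqP.
Qed.

End JBHom.

End SpinSystems.

(** * Spin families whose partial isometry is the unit of the algebra *)

Section UnitalSpinFamilies.
Variables (C : numClosedFieldType) (B : starAlgType C) (e : B).
Hypotheses (smul1x : forall x, e ** x = x) (smulx1 : forall x, x ** e = x).
Variables (k : nat) (t : 'I_k -> B).
Hypotheses (t_star : forall i, (t i)^** = t i) (t_sqr : forall i, t i ** t i = e)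
  (t_anti : forall i j, i != j -> t i ** t j = - (t j ** t i)).

Lemma star_unit : e^** = e.
Proof. by rewrite -[LHS]smul1x -{1}[e]starK -starM smul1x starK. Qed.

Lemma unital_spin_family : spin_family e t.
Proof. by split=> //; rewrite ?/tprod star_unit !smul1x. Qed.

Lemma unital_lin_indep (g : {linear B -> B}) : e != 0 -> g e = e ->
  (forall i x, g (t i ** x) = - (t i ** g x)) -> lin_indep (monomial e t).
Proof.
move=> e0 ge gt; apply: (monomial_lin_indep unital_spin_family e0 _ _ _ ge gt).
- by move=> i; rewrite smul1x.
- by move=> i; rewrite smulx1.
- by rewrite star_unit smul1x.
Qed.

End UnitalSpinFamilies.

Lemma lin_indep_span_full (C : numClosedFieldType) (V : vectType C) (I : finType)
    (X : I -> V) : lin_indep X -> #|I| = dim V -> fam_span X = [set: V].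
Proof.
move=> Xfree cardI; pose s := [tuple X (enum_val i) | i < #|I|].
have sE (i : 'I_#|I|) : s`_i = X (enum_val i) by rewrite -tnth_nth tnth_mktuple.
have s_free : free s.
  apply/freeP => c cs i; have := Xfree (fun x => c (enum_rank x)).
  rewrite (reindex_onto (@enum_val I predT) enum_rank) => [|x _]; last exact: enum_rankK.
  rewrite (eq_bigl xpredT) => [|j]; last by rewrite enum_valK eqxx.
  under eq_bigr do rewrite enum_valK -sE.
  by move=> /(_ cs (enum_val i)); rewrite enum_valK.
have s_full : basis_of fullv s.
  by rewrite basisEfree s_free subvf dimvf size_tuple cardI /=.
apply/seteqP; split=> // x _; exists (fun y => coord s (enum_rank y) x).
rewrite (reindex_onto (@enum_val I predT) enum_rank) => [|y _]; last exact: enum_rankK.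
rewrite (eq_bigl xpredT) => [|j]; last by rewrite enum_valK eqxx.
rewrite [LHS](coord_basis s_full (memvf x)).
by apply: eq_bigr => i _; rewrite enum_valK sE.
Qed.

Lemma card_set_ord k : #|{: {set 'I_k}}| = (2 ^ k)%N.
Proof. by rewrite -cardsT -powersetT card_powerset cardsT card_ord. Qed.

(** * Clifford matrices and the two full matrix models *)

Section MatrixModels.
Variable C : numClosedFieldType.

Lemma mxstar_block m (a b c d : 'M[C]_m) :
  mxstar (block_mx a b c d) = block_mx (mxstar a) (mxstar c) (mxstar b) (mxstar d).
Proof. by rewrite /mxstar map_block_mx tr_block_mx. Qed.

Lemma mxstar1 m : mxstar (1%:M : 'M[C]_m) = 1%:M.
Proof. by rewrite /mxstar map_mx1 trmx1. Qed.

Lemma mxstar0 m : mxstar (0 : 'M[C]_m) = 0.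
Proof. by rewrite /mxstar map_mx0 trmx0. Qed.

Lemma mxstarN m (a : 'M[C]_m) : mxstar (- a) = - mxstar a.
Proof. by apply/matrixP => i j; rewrite !mxE rmorphN. Qed.

Definition mx_clifford m k (t : 'I_k -> 'M[C]_m) : Prop :=
  [/\ forall i, mxstar (t i) = t i, forall i, t i *m t i = 1%:M
    & forall i j, i != j -> t i *m t j = - (t j *m t i)].

(** In terms of the Pauli matrices, the new generators are sigma_x and sigma_y tensored with the
    identity, and the old ones become sigma_z tensored with [t l]. *)
Definition mx_clifford_step m k (t : 'I_k -> 'M[C]_m) (i : 'I_k.+2) : 'M[C]_(m + m) :=
  match unlift ord0 i with
  | None => block_mx 0 1%:M 1%:M 0
  | Some j => match unlift ord0 j with
    | None => block_mx 0 (- 'i)%:M 'i%:M 0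
    | Some l => block_mx (t l) 0 0 (- t l)
    end
  end.

Lemma mx_clifford_stepP m k (t : 'I_k -> 'M[C]_m) :
  mx_clifford t -> mx_clifford (mx_clifford_step t).
Proof.
move=> [tstar tsqr tanti].
pose X : 'M[C]_(m + m) := block_mx 0 1%:M 1%:M 0.
pose Y : 'M[C]_(m + m) := block_mx 0 (- 'i)%:M 'i%:M 0.
pose Z l : 'M[C]_(m + m) := block_mx (t l) 0 0 (- t l).
have stepP i : (mx_clifford_step t i = X /\ i = ord0) +
    ((mx_clifford_step t i = Y /\ i = lift ord0 ord0) +
     {l | mx_clifford_step t i = Z l & i = lift ord0 (lift ord0 l)}).
  rewrite /mx_clifford_step; case: (unliftP ord0 i) => [j ->|->]; last by left.
  by case: (unliftP ord0 j) => [l ->|->]; right; [right; exists l | left].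
pose blockE := (mulmx_block, mul0mx, mulmx0, mul1mx, mulmx1, addr0, add0r,
  mul_scalar_mx, mul_mx_scalar).
have XY : X *m Y = - (Y *m X).
  by rewrite /X /Y !blockE opp_block_mx oppr0 (raddfN (@scalar_mx C m)) opprK.
have XZ l : X *m Z l = - (Z l *m X).
  by rewrite /X /Z !blockE opp_block_mx oppr0 opprK.
have YZ l : Y *m Z l = - (Z l *m Y).
  by rewrite /Y /Z !blockE opp_block_mx oppr0 !scalerN !scaleNr !opprK.
split=> [i|i|i j ij].
- case: (stepP i) => [[-> _]|[[-> _]|[l -> _]]].
  + by rewrite mxstar_block !mxstar0 mxstar1.
  + rewrite mxstar_block !mxstar0 /mxstar !map_scalar_mx !tr_scalar_mx /=.
    by rewrite rmorphN /= conjCi opprK.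
  + by rewrite mxstar_block !mxstar0 mxstarN tstar.
- case: (stepP i) => [[-> _]|[[-> _]|[l -> _]]].
  + by rewrite /X !blockE -scalar_mx_block.
  + rewrite /Y !blockE !scale_scalar_mx mulNr mulrN -expr2 sqrCi opprK.
    by rewrite -scalar_mx_block.
  + by rewrite /Z !blockE mulNmx mulmxN opprK tsqr -scalar_mx_block.
- case: (stepP i) (stepP j) ij => [[-> ->]|[[-> ->]|[l -> ->]]]
    [[-> ->]|[[-> ->]|[l' -> ->]]] => ij; rewrite ?eqxx// in ij *.
  + by rewrite XY opprK.
  + by rewrite XZ opprK.
  + by rewrite YZ opprK.
  + rewrite !(inj_eq lift_inj) in ij.
    by rewrite /Z !blockE opp_block_mx oppr0 !mulNmx !mulmxN !opprK tanti.
Qed.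

Lemma mx_clifford_ex n : exists t : 'I_n.*2.+1 -> 'M[C]_(2 ^ n), mx_clifford t.
Proof.
elim: n => [|n [t tP]].
  exists (fun=> 1%:M); split=> [i|i|i j].
  - exact: mxstar1.
  - by rewrite mul1mx.
  - by rewrite !ord1 eqxx.
have -> : (2 ^ n.+1 = 2 ^ n + 2 ^ n)%N by rewrite expnS mul2n addnn.
by exists (mx_clifford_step t); exact: mx_clifford_stepP.
Qed.

Lemma mx_smul1l m (x : 'M[C]_m) : 1%:M ** x = x.
Proof. exact: mul1mx. Qed.

Lemma mx_smul1r m (x : 'M[C]_m) : x ** 1%:M = x.
Proof. exact: mulmx1. Qed.

Lemma mx1_neq0 n : (1%:M : 'M[C]_(2 ^ n)) != 0.
Proof.
have n0 : (0 < 2 ^ n)%N by rewrite expn_gt0.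
apply/eqP => /matrixP /(_ (Ordinal n0) (Ordinal n0)) /eqP.
by rewrite !mxE eqxx oner_eq0.
Qed.

(** The generator at [ord0] is kept out of the family, and conjugation by it is the grading. The
    2^(2n) monomials match the dimension of the matrix algebra. *)
Lemma spin_matrix_even n : exists (e : 'M[C]_(2 ^ n)) t,
  [/\ @spin_family C (2 * n) _ e t, lin_indep (monomial e t)
    & fam_span (monomial e t) = [set: 'M[C]_(2 ^ n)]].
Proof.
have [t [tstar tsqr tanti]] := mx_clifford_ex n.
rewrite mul2n; exists 1%:M, (fun i => t (lift ord0 i)).
have anti i j : i != j ->
    t (lift ord0 i) ** t (lift ord0 j) = - (t (lift ord0 j) ** t (lift ord0 i)).
  by move=> ij; apply: tanti; rewrite (inj_eq lift_inj).
pose g (x : 'M[C]_(2 ^ n)) := (t ord0 ** x) ** t ord0.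
have glin : linear g.
  by move=> a x y; rewrite /g smul_linearr smul_linearl.
pose G : {linear 'M[C]_(2 ^ n) -> 'M[C]_(2 ^ n)} :=
  HB.pack g (GRing.isLinear.Build C _ _ *:%R g glin).
have tfree : lin_indep (monomial 1%:M (fun i => t (lift ord0 i))).
  apply: (unital_lin_indep (@mx_smul1l _) (@mx_smul1r _) _ _ anti (g := G)).
  - by move=> i; exact: tstar.
  - by move=> i; exact: tsqr.
  - exact: mx1_neq0.
  - by rewrite /= /g mx_smul1r; exact: tsqr.
  - move=> i x; rewrite /= /g !smulA -!smulNl; congr (_ ** _ ** _).
    by rewrite smulNl; apply: tanti; exact: neq_lift.
split=> //.
  apply: (unital_spin_family (@mx_smul1l _) _ _ anti).
  - by move=> i; exact: tstar.
  - by move=> i; exact: tsqr.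
apply: lin_indep_span_full => //.
by rewrite dim_matrix card_set_ord -addnn expnD.
Qed.

(** All 2n+1 generators are used, paired with their negatives, and the exchange of the summands is
    the grading. The 2^(2n+1) monomials match the dimension 2 * 4^n. *)
Lemma spin_matrix_odd n : exists (e : 'M[C]_(2 ^ n) * 'M[C]_(2 ^ n)) t,
  [/\ @spin_family C n.*2.+1 _ e t, lin_indep (monomial e t)
    & fam_span (monomial e t) = [set: 'M[C]_(2 ^ n) * 'M[C]_(2 ^ n)]].
Proof.
have [t [tstar tsqr tanti]] := mx_clifford_ex n.
pose B : starAlgType C := ('M[C]_(2 ^ n) * 'M[C]_(2 ^ n))%type.
pose e : B := (1%:M, 1%:M); pose u i : B := (t i, - t i); exists e, u.
have e1l (x : B) : e ** x = x by case: x => x y; congr pair; exact: mul1mx.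
have e1r (x : B) : x ** e = x by case: x => x y; congr pair; exact: mulmx1.
have ustar i : (u i)^** = u i.
  by congr pair; rewrite ?starN; [|congr (- _)]; exact: tstar.
have usqr i : u i ** u i = e.
  by congr pair; rewrite /= ?smulNl ?smulNr ?opprK; exact: tsqr.
have uanti i j : i != j -> u i ** u j = - (u j ** u i).
  by move=> /tanti tij; congr pair; rewrite /= ?smulNl ?smulNr ?opprK; exact: tij.
pose g (x : B) : B := (x.2, x.1).
have glin : linear g by [].
pose G : {linear B -> B} := HB.pack g (GRing.isLinear.Build C _ _ *:%R g glin).
have ufree : lin_indep (monomial e u).
  apply: (unital_lin_indep e1l e1r ustar usqr uanti (g := G)) => //.
  - apply/eqP => /(congr1 fst) /= /eqP; exact/negP/mx1_neq0.
  - by move=> i x; congr pair; rewrite /= ?smulNl ?opprK.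
split=> //; first exact: (unital_spin_family e1l).
apply: lin_indep_span_full => //.
rewrite -[RHS]/(2 ^ n * 2 ^ n + 2 ^ n * 2 ^ n)%N.
by rewrite card_set_ord expnS mul2n addnn -expnD addnn.
Qed.

End MatrixModels.

(** * TROs generated by a spin family *)

Section TROSpans.
Variable R : realType.
Local Notation C := R[i].
Implicit Types H K : hilbertType R.

(** The letter [t i] itself may lie outside [S], but t_i x = (t_i v) v* x for a word x, a triple
    product of members of [S]. *)
Lemma tro_word (A : starAlgType C) k (v : A) (t : 'I_k -> A) (S : set A) w :
  spin_family v t -> (forall x y z, S x -> S y -> S z -> S (tprod x y z)) ->
  S v -> (forall i, S (t i ** v)) -> S (word v t w).
Proof.
move=> vt Stp Sv St; elim: w => //= i w Sw.
have -> : t i ** word v t w = tprod (t i ** v) v (word v t w).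
  by rewrite /tprod -smulA -smulA [v ** _]smulA (pisom_word vt).
exact: Stp.
Qed.

Lemma tro_hom_word (A B : starAlgType C) k (v : A) (t : 'I_k -> A) (v' : B)
    (t' : 'I_k -> B) (S : set A) (T : set B) (f : A -> B) w :
  spin_family v t -> spin_family v' t' ->
  (forall x y z, S x -> S y -> S z -> S (tprod x y z)) ->
  tro_hom S T f -> S v -> (forall i, S (t i ** v)) ->
  f v = v' -> (forall i, f (t i ** v) = t' i ** v') ->
  f (word v t w) = word v' t' w.
Proof.
move=> vt vt' Stp [_ fl ft] Sv St fv ftv; elim: w => //= i w IH.
have tE (D : starAlgType C) (x : D) (u : 'I_k -> D) : spin_family x u ->
    u i ** word x u w = tprod (u i ** x) x (word x u w).
  by move=> xu; rewrite /tprod -smulA -smulA [x ** _]smulA (pisom_word xu).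
rewrite (tE _ _ _ vt) (tE _ _ _ vt') ft ?ftv ?fv ?IH//.
exact: tro_word.
Qed.

Lemma span_TRO H k (v : bop H) (t : 'I_k -> bop H) :
  spin_family v t -> is_TRO (fam_span (monomial v t)).
Proof.
move=> vt; split; [exact: fam_span_subspace | exact: fam_span_closed |].
by move=> x y z; apply: fam_span_tprod => i j l; exact: monomial_span_tprod.
Qed.

Lemma span_generates H k (v : bop H) (t : 'I_k -> bop H) (X T : set (bop H)) :
  spin_family v t -> is_TRO T -> generates_TRO X T ->
  T v -> (forall i, T (t i ** v)) -> X `<=` fam_span (monomial v t) ->
  T = fam_span (monomial v t).
Proof.
move=> vt [Tsub Tcl Ttp] [_ Tgen] Tv Tt Xspan; apply/seteqP; split.
  by apply: Tgen => //; exact: span_TRO.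
by apply: subspace_fam_span => // S; exact: tro_word.
Qed.

End TROSpans.

(** * Universality of the model and comparison with any universal TRO *)

Section SpinFactor.
Variables (R : realType) (A : cstarAlgType R) (Z : set A).
Variables (H : hilbertType R) (k : nat) (s : 'I_k -> bop H).
Hypotheses (ss : is_spin_system s) (id0 : bop_id H != 0).
Local Notation C := R[i].
Variables (f : A -> bop H) (g : bop H -> A).
Hypotheses (fP : jb_hom Z (spin_span s) f) (gP : jb_hom (spin_span s) Z g).
Hypotheses (gK : forall x, Z x -> g (f x) = x)
  (fK : forall y, spin_span s y -> f (g y) = y).

Let e1 := bop_id (hsum H).
Let m := model s.
Let U := fam_span (monomial e1 m).

Lemma model_spin_system : is_spin_system m.
Proof.
have [k2 sstar sij] := ss; split=> // i; first exact: (sf_star (model_spin_family ss)).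
move=> j; rewrite /m /model !bdiagM !smulNl !smulNr !opprK bdiagD sij.
by rewrite -bdiag_id bdiagZ.
Qed.

Definition spin_lift : bop H -> bop (hsum H) :=
  fam_ext (spin_basis s) (spin_basis m).

Lemma spin_lift_vec a c : spin_lift (spin_vec s a c) = spin_vec m a c.
Proof.
pose d i : C := oapp c a (unlift ord0 i).
have dE H' (r : 'I_k -> bop H') : spin_vec r a c = \sum_i d i *: spin_basis r i.
  rewrite spin_basis_sum /d unlift_none; congr (_ + _).
  by apply: eq_bigr => i _; rewrite liftK.
rewrite [in LHS]dE /spin_lift fam_extE -?dE//.
exact: spin_basis_lin_indep.
Qed.

Lemma spin_spanP (x : bop H) : spin_span s x -> exists a c, x = spin_vec s a c.
Proof. by []. Qed.

Lemma spin_vec_model a c : U (spin_vec m a c).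
Proof.
have Usub := fam_span_subspace (monomial e1 m).
have vt := model_spin_family ss.
have Uw w : U (word e1 m w) by exact: word_span.
apply: Usub.2; first exact: (Uw [::]).
apply: subspace_sum => // i; have := Uw [:: i].
by rewrite /= smul1r.
Qed.

Lemma spin_lift_linear : linear_on (spin_span s) spin_lift.
Proof. by rewrite spin_spanE; apply: fam_ext_linear; exact: spin_basis_lin_indep. Qed.

(** [s] and its model are spin systems of the same length, so their triple products have the same
    coordinates. *)
Lemma spin_lift_jb : jb_hom (spin_span s) U spin_lift.
Proof.
split; first by move=> _ /spin_spanP[a [c ->]]; rewrite spin_lift_vec; exact: spin_vec_model.
  exact: spin_lift_linear.
move=> _ _ _ /spin_spanP[a [c ->]] /spin_spanP[b [d ->]] /spin_spanP[e [h ->]].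
rewrite !spin_lift_vec (spin_vec_jprod ss) (spin_vec_jprod model_spin_system) -!spin_lift_vec.
set x := spin_vec s e h; set y := spin_vec s a c; set z := spin_vec s _ _.
have [Sx Sy Sz] : [/\ spin_span s x, spin_span s y & spin_span s z].
  by split; [exists e, h | exists a, c | exists (Num.conj b), (fun i => - Num.conj (d i))].
have [S0 SZD] : is_subspace (spin_span s) by rewrite spin_spanE; exact: fam_span_subspace.
have l0 : spin_lift 0 = 0.
  by have := spin_lift_linear (-1) S0 S0; rewrite !scaleN1r !addNr.
clearbody x y z; rewrite -!addrA -!scaleNr -[(- _) *: z]addr0 !spin_lift_linear ?l0 ?addr0//.
- by rewrite -[_ *: z]addr0; exact: SZD.
- by apply: (SZD) => //; rewrite -[_ *: z]addr0; exact: SZD.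
Qed.

Let rho := spin_lift \o f.

Lemma spin_vec_id : spin_vec s 1 (fun=> 0) = bop_id H.
Proof. by rewrite /spin_vec scale1r big1 ?addr0// => i _; rewrite scale0r. Qed.

Lemma spin_lift_id : spin_lift (bop_id H) = e1.
Proof.
rewrite -spin_vec_id spin_lift_vec /spin_vec scale1r big1 ?addr0// => i _.
by rewrite scale0r.
Qed.

Lemma spin_lift_gen i : spin_lift (s i) = m i.
Proof.
have vecE H' (r : 'I_k -> bop H') : spin_vec r 0 (fun j => (j == i)%:R) = r i.
  rewrite /spin_vec scale0r add0r (bigD1 i)//= eqxx scale1r big1 ?addr0// => j.
  by move=> /negbTE ->; rewrite scale0r.
by rewrite -[in LHS]vecE spin_lift_vec vecE.
Qed.

Section Factorization.
Variables (B : starAlgType C) (S : set B) (alpha : A -> B).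
Hypothesis alphaP : jb_hom Z S alpha.
Let v := alpha (g (bop_id H)).
Let t i := alpha (g (s i)) ** v^**.

Lemma alpha_gen : jb_hom (spin_span s) S (alpha \o g).
Proof. exact: jb_hom_comp gP alphaP. Qed.

Lemma alpha_family : spin_family v t.
Proof. exact: (jb_hom_spin_family ss alpha_gen). Qed.

Lemma alpha_gen_t i : t i ** v = alpha (g (s i)).
Proof. exact: (jb_hom_spin_gen ss alpha_gen). Qed.

Lemma alpha_unit_mem : S v.
Proof. by have [h _ _] := alpha_gen; apply: h; exact: spin_span_id. Qed.

Lemma alpha_gen_mem i : S (t i ** v).
Proof. by rewrite alpha_gen_t; have [h _ _] := alpha_gen; apply: h; exact: spin_span_gen. Qed.

(** The same coordinates serve [f z] and [alpha z], which reduces the factorization to words of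
    length at most one. *)
Lemma alphaE z : Z z -> exists c : 'I_k.+1 -> C,
  f z = \sum_i c i *: spin_basis s i /\
  alpha z = \sum_i c i *: oapp (fun j => t j ** v) v (unlift ord0 i).
Proof.
move=> Zz; have [fS _ _] := fP.
have := fS _ Zz; rewrite spin_spanE => -[c fz]; exists c; split=> //.
have [_ al _] := alpha_gen.
rewrite -[in alpha z](gK Zz) fz -[LHS]/((alpha \o g) _).
have Ssub : is_subspace (spin_span s) by rewrite spin_spanE; exact: fam_span_subspace.
rewrite (linear_on_sum _ _ Ssub al).
  apply: eq_bigr => i _; congr (_ *: _); rewrite /spin_basis /=.
  by case: (unlift ord0 i) => [j|] //=; rewrite alpha_gen_t.
by move=> i; rewrite spin_spanE; exact: fam_span_mem.
Qed.

Lemma alpha_span z : Z z -> fam_span (monomial v t) (alpha z).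
Proof.
move=> /alphaE[c [_ ->]]; apply: subspace_sum; first exact: fam_span_subspace.
move=> i; case: (unlift ord0 i) => [j|] /=.
  exact: (word_span alpha_family [:: j]).
exact: (word_span alpha_family [::]).
Qed.

End Factorization.

(** A TRO containing the image contains the identity and the generators of the model, hence all
    words. A homomorphism [alpha] factors through the map that sends each model monomial to the same
    monomial in the spin family of [alpha]. *)
Lemma model_universal : is_universal_TRO Z U rho.
Proof.
have vt := model_spin_family ss.
have free := model_lin_indep ss id0.
have rhoP : jb_hom Z U rho := jb_hom_comp fP spin_lift_jb.
have Zid : Z (g (bop_id H)) by have [h _ _] := gP; apply: h; exact: spin_span_id.
have Zs i : Z (g (s i)) by have [h _ _] := gP; apply: h; exact: spin_span_gen.
have rho1 : rho (g (bop_id H)) = e1.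
  by rewrite /rho /= fK ?spin_lift_id//; exact: spin_span_id.
have rhos i : rho (g (s i)) = m i.
  by rewrite /rho /= fK ?spin_lift_gen//; exact: spin_span_gen.
split=> //; first exact: span_TRO.
  split=> [_ [z Zz <-]|S [Ssub _ Stp] rhoS]; first by have [h _ _] := rhoP; exact: h.
  apply: subspace_fam_span => // M; apply: (tro_word _ vt) => // [|i].
    by rewrite -[X in S X]rho1; apply: rhoS; exists (g (bop_id H)).
  by rewrite smul1r -[X in S X]rhos; apply: rhoS; exists (g (s i)).
move=> K S alpha [Ssub _ Stp] alphaP.
have vt' := alpha_family alphaP.
exists (fam_ext (monomial e1 m) (monomial (alpha (g (bop_id H)))
  (fun i => alpha (g (s i)) ** (alpha (g (bop_id H)))^**))).
  apply: monomial_tro_hom => // M; apply: (tro_word _ vt') => //.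
    exact: (alpha_unit_mem alphaP).
  exact: (alpha_gen_mem alphaP).
move=> z Zz; have [c [fz ->]] := alphaE alphaP Zz.
rewrite /rho /= fz.
have Ssp : is_subspace (spin_span s) by rewrite spin_spanE; exact: fam_span_subspace.
have Sb i : spin_span s (spin_basis s i) by rewrite spin_spanE; exact: fam_span_mem.
rewrite (linear_on_sum _ _ Ssp spin_lift_linear)//.
have wordE w := fam_ext_word w vt vt' free.
have lE i : spin_lift (spin_basis s i) = word e1 m (oapp (fun j => [:: j]) [::] (unlift ord0 i)).
  rewrite /spin_basis; case: (unlift ord0 i) => [j|] /=; last exact: spin_lift_id.
  by rewrite smul1r spin_lift_gen.
under [in RHS]eq_bigr do rewrite lE.
rewrite (linear_on_sum _ _ (fam_span_subspace _) (fam_ext_linear _ free)); last first.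
  by move=> i; exact: word_span.
apply: eq_bigr => i _; congr (_ *: _); rewrite wordE.
by case: (unlift ord0 i).
Qed.

(** The universal property of [T] gives a homomorphism to the model that carries the monomials of
    [T] to the independent model monomials. Those of [T] are then independent as well, and matching
    them with the given spanning monomials is the isomorphism. *)
Lemma universal_tro_iso K (T : set (bop K)) (r : A -> bop K)
    (B : starAlgType C) (v : B) (t : 'I_k -> B) :
  is_universal_TRO Z T r -> spin_family v t -> lin_indep (monomial v t) ->
  fam_span (monomial v t) = [set: B] -> tro_iso T [set: B].
Proof.
move=> [TRO rP rgen runiv] vt vfree vfull.
have [Tsub _ Ttp] := TRO.
have [_ rhoP _ _] := model_universal.
have UTRO : is_TRO U by apply: span_TRO; exact: model_spin_family.
have [phi phiP rhoE] := runiv _ _ _ UTRO rhoP.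
have ut := alpha_family rP.
set u := r (g (bop_id H)) in ut; set q := (fun i => _) in ut.
have Tu : T u := alpha_unit_mem rP.
have Tq i : T (q i ** u) := alpha_gen_mem rP i.
have TE : T = fam_span (monomial u q).
  apply: span_generates TRO rgen Tu Tq _ => //.
  by move=> _ [z Zz <-]; exact: (alpha_span rP).
have Zid : Z (g (bop_id H)) by have [h _ _] := gP; apply: h; exact: spin_span_id.
have Zs i : Z (g (s i)) by have [h _ _] := gP; apply: h; exact: spin_span_gen.
have phiu : phi u = e1.
  by rewrite -rhoE// /rho /= fK ?spin_lift_id//; exact: spin_span_id.
have phiq i : phi (q i ** u) = m i ** e1.
  rewrite (alpha_gen_t rP) -rhoE// /rho /= fK ?spin_lift_gen ?smul1r//.
  exact: spin_span_gen.
have ufree : lin_indep (monomial u q).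
  move=> c /(congr1 phi); have [_ phil _] := phiP.
  rewrite (linear_on_sum _ _ Tsub phil); last by move=> M; exact: (tro_word _ ut).
  have := phil (-1) 0 0 Tsub.1 Tsub.1; rewrite !scaleN1r !addNr => -> c0.
  apply: (model_lin_indep ss id0); rewrite -[RHS]c0; apply: eq_bigr => M _.
  by rewrite /monomial (tro_hom_word _ ut (model_spin_family ss) Ttp phiP Tu Tq phiu phiq).
exists (fam_ext (monomial u q) (monomial v t)); rewrite TE.
  by apply: monomial_tro_hom.
by rewrite -vfull; exact: fam_ext_bij.
Qed.

End SpinFactor.

(** * Existence, identification of the length by dimension, and the two parities *)

Theorem theorem3p5 (R : realType) (A : cstarAlgType R) (Z : set A) (k : nat) :
  is_spin_factor Z -> has_dim Z k.+1 ->
  (exists (H : hilbertType R) (T : set (bop H)) (rho : A -> bop H),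
     is_universal_TRO Z T rho) /\
  (forall (H : hilbertType R) (T : set (bop H)) (rho : A -> bop H),
     is_universal_TRO Z T rho ->
     (forall n : nat, k = (2 * n - 1)%N ->
        tro_iso T [set: ('M[R[i]]_(2 ^ (n - 1)) * 'M[R[i]]_(2 ^ (n - 1)))%type]) /\
     (forall n : nat, k = (2 * n)%N ->
        tro_iso T [set: 'M[R[i]]_(2 ^ n)])).
Proof.
move=> [[Zsub _ Zj] [H [k' [s [ss [f fP fbij]]]]]] [b [Zb bfree bspan]].
have [g [gP gK fK]] := jb_hom_inverse Zsub Zj fP fbij.
have [_ finj _] := fbij; have [fS fl _] := fP; have [gS gl _] := gP.
have bspanE : Z `<=` fam_span b by move=> x /bspan[c ->]; exists c.
(* On the zero space the spin span would be 0, while [Z] has dimension at least 1. *)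
have id0 : bop_id H != 0.
  apply/eqP => id0.
  have bop0 (x : bop H) : x = 0 by rewrite -[x]smul1l id0 smul0l.
  have b0 : b ord0 = 0.
    by apply: finj; rewrite ?inE ?[f _]bop0//; exact: Zsub.1.
  have := bfree (fun i => (i == ord0)%:R).
  rewrite (bigD1 ord0)//= scale1r b0 add0r big1 => [/(_ erefl ord0)|i].
    by rewrite eqxx => /eqP; rewrite oner_eq0.
  by move=> /negbTE ->; rewrite scale0r.
have sfree := spin_basis_lin_indep ss id0.
have sspan i : spin_span s (spin_basis s i) by rewrite spin_spanE; exact: fam_span_mem.
(* The spin system comes with its own length [k']; the isomorphism transports bases both ways, so
   the dimensions k+1 and k'+1 agree. *)
have kk' : k = k'.
  apply/eqP; rewrite -eqSS eqn_leq; apply/andP; split.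
    apply: (lin_indep_size (Y := spin_basis s)
      (lin_indep_image Zsub fl finj Zb bfree)) => i.
    by rewrite -spin_spanE; exact: fS.
  have sub : is_subspace (spin_span s) by rewrite spin_spanE; exact: fam_span_subspace.
  have ginj : set_inj (spin_span s) g.
    by move=> x y; rewrite !inE => Sx Sy xy; rewrite -(fK _ Sx) xy fK.
  apply: (lin_indep_size (Y := b) (lin_indep_image sub gl ginj sspan sfree)) => i.
  by apply: bspanE; exact: gS.
subst k'; split.
  exists (hsum H), (fam_span (monomial (bop_id (hsum H)) (model s))), (spin_lift s \o f).
  exact: (model_universal ss id0 fP gP gK fK).
move=> K T rho Tuniv; split=> [[|n]|n] kE.
(* For n = 0 the truncated subtraction gives k = 0, against 2 <= k. *)
- by exfalso; have [k2 _ _] := ss; move: k2; rewrite {1}kE.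
- have [v [t [vt vfree vfull]]] := spin_matrix_odd R[i] n.
  (* The n here is one less than that of the statement: 2 (n+1) - 1 = 2n + 1. *)
  have kn : k = n.*2.+1 by rewrite kE mul2n doubleS subn1.
  clear kE; subst k; have -> : (n.+1 - 1)%N = n by rewrite subn1.
  exact: (universal_tro_iso ss id0 fP gP gK fK Tuniv vt vfree vfull).
- subst k; have [v [t [vt vfree vfull]]] := spin_matrix_even R[i] n.
  exact: (universal_tro_iso ss id0 fP gP gK fK Tuniv vt vfree vfull).
Qed.
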